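(* Let $\phi:[0,1)\to[0,1)$ be an increasing concave function such that $\phi(0+)=0$ and let $$\psi(u):=\inf_{1<w<\frac1u}\frac{\phi(uw)}{1+\log(w)},\quad u\in[0,1).$$ If the inequality $$\int_0^u\frac{\psi(t)}{t}\,dt+u\int_u^1\frac{\psi(t)}{t^2}\,dt\le c_{\phi,\psi}\,\phi(u),\quad u\in(0,1),$$ holds for some constant $c_{\phi,\psi}$, then: (i) The Calderón operator $S:\Lambda_\phi\to\Lambda_\psi$ is bounded; (ii) for every $x\in\Lambda_\psi$ there exists $y\in\Lambda_\phi$ such that $\mu(x)\le S\mu(y)$ and $\|y\|_{\Lambda_\phi}\le 8\|x\|_{\Lambda_\psi}$.
   Context: All functions are real-valued measurable functions on $(0,1)$ with Lebesgue measure $m$, identified when equal a.e.; $\log$ is the natural logarithm. Decreasing rearrangement: $\mu(x)=\mu(\cdot;x)$, $\mu(t;x):=\inf\{s\ge 0: m(\{u:|x(u)|>s\})\le t\}$. Calderón operator: $(Sx)(t)=\frac1t\int_0^t x(s)\,ds+\int_t^1\frac{x(s)}{s}\,ds$, $x\in L_1(0,1)$. Lorentz space: $\Lambda_\phi=\{x \text{ measurable on }(0,1): \|x\|_{\Lambda_\phi}:=\int_0^1\mu(s;x)\,d\phi(s)<\infty\}$ ($\phi$ increasing, $\phi(0+)=0$), and $\Lambda_\psi$, $\|\cdot\|_{\Lambda_\psi}$ are given by the same formula with $\psi$ in place of $\phi$. At $u=0$ the infimum defining $\psi$ is over $1<w<\infty$. *)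

(* Defs.v *)
From HB Require Import structures.
From mathcomp Require Import all_boot all_order all_algebra.
From mathcomp Require Import all_classical all_reals all_analysis.
From mathcomp Require Import lra.
Import Order.TTheory GRing.Theory Num.Theory.
Import numFieldNormedType.Exports.

Set Implicit Arguments.
Unset Strict Implicit.
Unset Printing Implicit Defensive.

Local Open Scope classical_set_scope.
Local Open Scope ring_scope.

(* Functions on (0,1) or on [0,1) are represented by total functions R -> R,
   of which only the values on the relevant interval are ever used. *)

Section StieltjesExtension.
Context {R : realType}.
Implicit Types (F : R -> R) (s t : R).

Definition stieltjes_weight F : Prop :=
  {in `[0, 1[ &, {homo F : s t / s <= t}} /\ has_ubound (F @` `[0, 1[).

(* The distribution function t |-> F(t+), constant outside [0,1), which
   generates the Lebesgue-Stieltjes measure dF on (0,1). The value 0 for an F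
   that is not a weight is a dummy that makes the definition total. *)
Definition stieltjes_ext F : R -> R := fun t =>
  if `[< stieltjes_weight F >] then
    if t < 1 then inf (F @` `]Num.max t 0, 1[) else sup (F @` `[0, 1[)
  else 0.

Let max0_lt1 t : t < 1 -> Num.max t 0 < 1.
Proof. by move=> t1; rewrite gt_max t1 ltr01. Qed.

Let memF t s : t < 1 -> Num.max t 0 < s < 1 -> s \in `[0, 1[.
Proof.
move=> t1 /andP[ts s1]; rewrite in_itv/= s1 andbT ltW//.
by apply: le_lt_trans ts; rewrite le_max lexx orbT.
Qed.

Let nonempty_right F t : t < 1 -> F @` `]Num.max t 0, 1[ !=set0.
Proof.
move=> /max0_lt1 t1; exists (F ((Num.max t 0 + 1) / 2)).
by exists ((Num.max t 0 + 1) / 2) => //=; rewrite in_itv/=; apply/andP; split; lra.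
Qed.

Let has_lbound_right F t : stieltjes_weight F -> t < 1 ->
  has_lbound (F @` `]Num.max t 0, 1[).
Proof.
move=> [ndF _] t1; exists (F 0) => _ [s /= + <-]; rewrite in_itv/= => ts.
have s01 := memF t1 ts.
apply: ndF => //; first by rewrite in_itv/= lexx ltr01.
by move: s01; rewrite in_itv/= => /andP[].
Qed.

Let stieltjes_ext_nd F : nondecreasing (stieltjes_ext F).
Proof.
move=> s t st; rewrite /stieltjes_ext; case: asboolP => // wF.
case: (ltP t 1) => t1.
  have s1 : s < 1 by exact: le_lt_trans t1.
  rewrite s1; apply: lb_le_inf; first exact: nonempty_right.
  move=> _ [r /= + <-]; rewrite in_itv/= => /andP[tr r1].
  apply: ge_inf; first exact: has_lbound_right.
  exists r => //=; rewrite in_itv/= r1 andbT; apply: le_lt_trans tr.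
  by rewrite ge_max le_max st/= le_max lexx orbT.
case: ifPn => [s1|//].
have [y [r /= r01 ry]] := nonempty_right F s1.
apply: (@le_trans _ _ (F r)).
  by apply: ge_inf; [exact: has_lbound_right|exists r].
apply: ub_le_sup; first by case: wF.
by exists r => //=; move: r01; rewrite in_itv/= => /(memF s1).
Qed.

Let stieltjes_ext_rc F : right_continuous (stieltjes_ext F).
Proof.
move=> t; apply/cvgrPdist_le => /= e e0.
suff [d d0 Hd] : exists2 d, 0 < d &
    stieltjes_ext F (t + d) <= stieltjes_ext F t + e.
  near=> s.
  have ts : t < s by near: s; exact: nbhs_right_gt.
  have std : s <= t + d by near: s; apply: nbhs_right_le; rewrite ltrDl.
  rewrite distrC ger0_norm; last by rewrite subr_ge0 stieltjes_ext_nd// ltW.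
  by rewrite lerBlDl (le_trans _ Hd)// stieltjes_ext_nd.
rewrite /stieltjes_ext; case: asboolP => wF; last first.
  by exists 1 => //; rewrite add0r ltW.
have [t1|t1] := ltP t 1; last first.
  have t11 : (t + 1 < 1) = false by apply/negbTE; rewrite -leNgt; lra.
  by exists 1 => //; rewrite t11 lerDl ltW.
have hi : has_inf (F @` `]Num.max t 0, 1[).
  by split; [exact: nonempty_right|exact: has_lbound_right].
have [_ [r /= + <-] Fr] := inf_adherent e0 hi.
rewrite in_itv/= => /andP[tr r1].
have tr' : t < r by apply: le_lt_trans tr; rewrite le_max lexx.
have r0 : 0 < r by apply: le_lt_trans tr; rewrite le_max lexx orbT.
have h1 : t + (r - t) / 2 < r by lra.
exists ((r - t) / 2); first by lra.
rewrite (lt_trans h1 r1); apply: le_trans (ltW Fr).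
apply: ge_inf; first by apply: has_lbound_right => //; exact: lt_trans r1.
by exists r => //=; rewrite in_itv/= r1 andbT gt_max h1.
Unshelve. all: by end_near. Qed.

HB.instance Definition _ F := isCumulative.Build R _ R (stieltjes_ext F)
  (@stieltjes_ext_nd F) (@stieltjes_ext_rc F).

End StieltjesExtension.

Section Definitions.
Context {R : realType}.
Implicit Types (F phi x : R -> R) (t u : R).

Local Notation m := (@lebesgue_measure R).

Definition rearrangement x t : R :=
  inf [set s | 0 <= s /\
               (m [set u | (0 < u < 1)%R /\ (s < `|x u|)%R] <= t%:E)%E].

Definition L1 : set (R -> R) := [set x : R -> R | m.-integrable `]0, 1[ (EFin \o x)].

(* Only meaningful for x in L1. *)
Definition calderon x t : R :=
  t^-1 * Rintegral m `]0, t[ x + Rintegral m `]t, 1[ (fun s => x s / s).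

Definition lorentz_norm F x : \bar R :=
  (\int[lebesgue_stieltjes_measure (stieltjes_ext F)]_(s in `]0%R, 1%R[)
     (rearrangement x s)%:E)%E.

Definition lorentz F : set (R -> R) :=
  [set x : R -> R | measurable_fun (`]0, 1[ : set R) x /\ (lorentz_norm F x < +oo)%E].

(* The condition u * w < 1 reads w < 1/u for u > 0 and is void for u = 0. *)
Definition psi_of phi u : R :=
  inf [set phi (u * w) / (1 + ln w) | w in [set w | 1 < w /\ u * w < 1]].

(* So that the dummy case of stieltjes_ext never occurs for psi. *)
Lemma psi_of_weight phi :
  (forall t, t \in `[0, 1[ -> 0 <= phi t < 1) ->
  {in `[0, 1[ &, {homo phi : s t / s <= t}} ->
  stieltjes_weight (psi_of phi).
Proof.
move=> phi01 ndphi.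
have dom u w : 0 <= u -> 1 < w -> u * w < 1 -> u * w \in `[0, 1[.
  by move=> u0 w1 uw1; rewrite in_itv/= uw1 andbT mulr_ge0// ltW// (lt_trans ltr01).
have den w : 1 < w -> 0 < 1 + ln w by move=> w1; rewrite addr_gt0// ln_gt0.
have lb u : 0 <= u -> lbound
    [set phi (u * w) / (1 + ln w) | w in [set w | 1 < w /\ u * w < 1]] 0.
  move=> u0 _ [w /= [w1 uw1] <-].
  have /andP[h _] := phi01 _ (dom _ _ u0 w1 uw1).
  by rewrite divr_ge0// ltW// den.
have ne u : 0 <= u -> u < 1 -> exists w, 1 < w /\ u * w < 1.
  move=> u0 u1; exists (2 / (1 + u)).
  by rewrite mulrA ltr_pdivlMr ?ltr_pdivrMr; [split|..]; lra.
split.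
  move=> u v; rewrite !in_itv/= => /andP[u0 u1] /andP[v0 v1] uv.
  apply: lb_le_inf.
    by have [w hw] := ne _ v0 v1; exists (phi (v * w) / (1 + ln w)), w.
  move=> _ [w /= [w1 vw1] <-].
  have uvw : u * w <= v * w by rewrite ler_wpM2r// ltW// (lt_trans ltr01).
  have uw1 : u * w < 1 by exact: le_lt_trans vw1.
  apply: (@le_trans _ _ (phi (u * w) / (1 + ln w))).
    by apply: ge_inf; [exists 0; exact: lb|exists w].
  by rewrite ler_pM2r ?invr_gt0 ?den// ndphi// dom.
exists 1 => _ [u /= + <-]; rewrite in_itv/= => /andP[u0 u1].
have [w [w1 uw1]] := ne _ u0 u1.
apply: (@le_trans _ _ (phi (u * w) / (1 + ln w))).
  by apply: ge_inf; [exists 0; exact: lb|exists w].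
have /andP[_ h] := phi01 _ (dom _ _ u0 w1 uw1).
rewrite ler_pdivrMr ?den// mul1r (le_trans (ltW h))// lerDl ltW//.
exact: ln_gt0.
Qed.

Definition concave01 F : Prop :=
  forall s t a, s \in `[0, 1[ -> t \in `[0, 1[ -> a \in `[0, 1] ->
    a * F s + (1 - a) * F t <= F (a * s + (1 - a) * t).

(* Boundedness of the Calderon operator from the space of phi to that of psi;
   the first clause says that the operator is defined on the whole source. *)
Definition calderon_bounded phi psi : Prop :=
  lorentz phi `<=` L1 /\
  exists C : R, forall x, lorentz phi x ->
    lorentz psi (calderon x) /\
    (lorentz_norm psi (calderon x) <= C%:E * lorentz_norm phi x)%E.

End Definitions.

(* Main.v *)
Require Import Defs.
From HB Require Import structures.
From mathcomp Require Import all_boot all_order all_algebra.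
From mathcomp Require Import all_classical all_reals all_analysis.
From mathcomp Require Import measurable_realfun lra ring.
Import Order.TTheory GRing.Theory Num.Theory.
Import numFieldNormedType.Exports.
Local Open Scope classical_set_scope.
Local Open Scope ring_scope.

(** Write d_x(s) for the Lebesgue measure of the set of u in (0,1) where
    |x u| > s, and dF for the Stieltjes measure of a weight F on (0,1). The
    functions phi and psi := psi_of phi are quasi-concave
    ([concave_quasiconcave], [psi_of_quasiconcave]), so the dF-measure of the
    interval ]0,a[ is F(a) for 0 < a < 1. Since s lies in ]0, d_x(l)[ only if
    the rearrangement of x is at least l at s, summing over the dyadic levels
    l = 2^k d gives, for every d > 0,
      sum_k 2^(k+1) d F(d_x(2^k d)) <= 4 ||x||_F     ([dyadic_distribution_le]),
    and this single inequality carries both halves of the theorem.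

    (i) Decomposing |x| at the dyadic levels shows that
    int |x| k <= 4 C ||x||_phi as soon as the integral of k over any set E is
    at most C phi(|E|) ([integral_lorentz_le]). Since
    1 / max(s,t) = 1 + int_(max(s,t))^1 r^-2 dr, Tonelli's theorem gives
      |S x(t)| <= int_0^1 |x| + int_t^1 r^-2 int_0^r |x(s)| ds dr
    ([calderon_majorant]). The right-hand side is nonincreasing in t, hence it
    also dominates the rearrangement of S x; integrating it against dpsi and
    exchanging the integrals again bounds ||S x||_psi by
    psi(1-) int |x| + int |x| k with k(s) = int_s^1 psi(r) / r^2 dr. The
    integral of k over E is at most
    int_0^1 psi(r) min(r, |E|) / r^2 dr, which is exactly the quantity that
    the hypothesis bounds by a multiple of phi(|E|) ([kernel_integral_le]).

    (ii) For the indicator of ]0,u[, take w with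
    phi(u w) / (1 + ln w) < 3/2 psi(u); then the function equal to
    1 / (1 + ln w) on ]0, u w[ and to 0 elsewhere has image at least 1 on
    ]0,u[ under S, and norm at most 3/2 psi(u) ([psi_of_majorant]). For a
    general x, take for y the constant d plus the sum over k of 2^(k+1) d times
    the function chosen for u = d_x(2^k d). As S is positive, a single term of
    this sum already gives the lower bound at a given point, and the dyadic
    inequality yields ||y||_phi <= d phi(1-) + 6 ||x||_psi
    ([rearrangement_majorant]); d = ||x||_psi / phi(1-) makes the constant 7. *)

Set Implicit Arguments.
Unset Strict Implicit.

(** * Monotone functions, Tonelli's theorem on a triangle, dyadic sums *)
Section Tools.
Context {R : realType}.
Implicit Types (D : set R).
Local Notation RR := (measurableTypeR R).
Local Notation I01 := (`]0, 1[%classic : set R).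
Local Notation leb := (@lebesgue_measure R).

Lemma nonincreasing_emeasurable (D : set R) (f : R -> \bar R) :
  is_interval D -> (forall s t, D s -> D t -> s <= t -> (f t <= f s)%E) ->
  measurable_fun D f.
Proof.
move=> iD fD.
have mD : measurable D by exact: is_interval_measurable.
apply: (measurability (@ErealGenOInfty.G R)) => [|/= _ [_] [r ->] <-].
  exact: ErealGenOInfty.measurableE.
apply: is_interval_measurable => s t /= [Ds _] [Dt].
rewrite !in_itv/= !andbT => ft u /andP[su ut].
have Du : D u by apply: (iD s t) => //; rewrite su ut.
by split=> //; rewrite in_itv/= andbT (lt_le_trans ft)// fD.
Qed.

Lemma nondecreasing_emeasurable (D : set R) (f : R -> \bar R) :
  is_interval D -> (forall s t, D s -> D t -> s <= t -> (f s <= f t)%E) ->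
  measurable_fun D f.
Proof.
move=> iD fD.
have mD : measurable D by exact: is_interval_measurable.
apply: (measurability (@ErealGenOInfty.G R)) => [|/= _ [_] [r ->] <-].
  exact: ErealGenOInfty.measurableE.
apply: is_interval_measurable => s t /= [Ds].
rewrite !in_itv/= !andbT => fs [Dt _] u /andP[su ut].
have Du : D u by apply: (iD s t) => //; rewrite su ut.
by split=> //; rewrite in_itv/= andbT (lt_le_trans fs)// fD.
Qed.

Lemma measurable_lt2 : measurable [set p : RR * RR | (p.1 < p.2)%R].
Proof.
have -> : [set p : RR * RR | (p.1 < p.2)%R] =
    setT `&` (fun p : RR * RR => (p.2 : R) - (p.1 : R)) @^-1` `]0, +oo[%classic.
  by apply/seteqP; split=> p /=; rewrite in_itv/= andbT subr_gt0; tauto.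
have mB : @measurable_fun _ _ (RR * RR)%type R setT
    (fun p : RR * RR => (p.2 : R) - (p.1 : R)).
  by apply: measurable_funB; [exact: measurable_snd|exact: measurable_fst].
by apply: mB => //; exact: measurable_itv.
Qed.

(** Both sides are the integral of g1(s) g2(r) over the triangle
    0 < s < r < 1. *)
Lemma tonelli_triangle (nu : {sigma_finite_measure set RR -> \bar R})
    (g1 g2 : R -> \bar R) :
  (forall s, I01 s -> (0 <= g1 s)%E) -> (forall s, I01 s -> (0 <= g2 s)%E) ->
  measurable_fun I01 g1 -> measurable_fun I01 g2 ->
  (\int[nu]_(s in I01) (g1 s * \int[leb]_(r in `]s, 1%R[) g2 r) =
   \int[leb]_(r in I01) (g2 r * \int[nu]_(s in `]0%R, r[) g1 s))%E.
Proof.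
move=> g10 g20 mg1 mg2.
have mD : measurable I01 by exact: measurable_itv.
pose h1 : RR -> \bar R := g1 \_ I01; pose h2 : RR -> \bar R := g2 \_ I01.
have mh1 : measurable_fun setT h1 by apply/(measurable_restrictT _ _).1.
have mh2 : measurable_fun setT h2 by apply/(measurable_restrictT _ _).1.
have h10 s : (0 <= h1 s)%E by apply: erestrict_ge0.
have h20 s : (0 <= h2 s)%E by apply: erestrict_ge0.
pose T := [set p : RR * RR | (p.1 < p.2)%R].
pose F (p : RR * RR) := (h1 p.1 * h2 p.2 * (\1_T p)%:E)%E.
have mF : measurable_fun setT F.
  apply: emeasurable_funM.
    apply: emeasurable_funM.
      by apply: measurableT_comp => //; exact: measurable_fst.
    by apply: measurableT_comp => //; exact: measurable_snd.
  by apply/measurable_EFinP; apply: measurable_indic; exact: measurable_lt2.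
have F0 p : (0 <= F p)%E by rewrite /F !mule_ge0// lee_fin.
have := @fubini_tonelli _ _ _ _ _ nu leb F mF F0.
rewrite (@integral_mkcond _ RR _ nu I01) (@integral_mkcond _ RR _ leb I01).
have mI (a b : R) : measurable `]a, b[%classic by exact: measurable_itv.
have -> : (fun x => \int[leb]_y F (x, y))%E =
    ((fun s => g1 s * \int[leb]_(r in `]s, 1%R[) g2 r) \_ I01)%E.
  apply/funext => s; rewrite patchE; case: ifPn => sD; last first.
    apply: integral0_eq => r _; rewrite /F /= /h1 patchE (negbTE sD).
    by rewrite !mul0e.
  have [s0 s1] : 0 < s /\ s < 1.
    by move: sD; rewrite inE/= in_itv/= => /andP[].
  rewrite -ge0_integralZl//.
  - rewrite [RHS]integral_mkcond; apply: eq_integral => r _.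
    rewrite /F /h1 /h2 !patchE sD indicE /=.
    have -> : (r \in `]s, 1[%classic) = (r \in I01) && ((s, r) \in T).
      apply/idP/andP; rewrite !inE/= /T/= !in_itv/=.
        by move=> /andP[sr r1]; split=> //; rewrite r1 (lt_trans s0).
      by move=> [/andP[? ?] ?]; apply/andP.
    case: ifP => /= rD; last by rewrite mule0 mul0e.
    by case: ifP => _; rewrite ?mule1 ?mule0.
  - apply: measurable_funS mg2 => //.
    by move=> r /=; rewrite !in_itv/= => /andP[sr ->]; rewrite (lt_trans s0).
  - move=> r /= ; rewrite in_itv/= => /andP[sr r1]; apply: g20 => /=.
    by rewrite in_itv/= r1 (lt_trans s0).
  - by apply: g10; rewrite inE in sD.
move=> ->; apply: eq_integral => r _.
rewrite patchE; case: ifPn => rD; last first.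
  apply: integral0_eq => s _; rewrite /F /= /h2 patchE (negbTE rD).
  by rewrite mule0 mul0e.
have [r0 r1] : 0 < r /\ r < 1.
  by move: rD; rewrite inE/= in_itv/= => /andP[].
rewrite -ge0_integralZl//.
- rewrite [RHS]integral_mkcond; apply: eq_integral => s _.
  rewrite /F /h1 /h2 !patchE rD indicE /=.
  have -> : (s \in `]0, r[%classic) = (s \in I01) && ((s, r) \in T).
    apply/idP/andP; rewrite !inE/= /T/= !in_itv/=.
      by move=> /andP[s0 sr]; split=> //; rewrite s0 (lt_trans sr).
    by move=> [/andP[? ?] ?]; apply/andP.
  case: ifP => /= sD; last by rewrite !mul0e.
  by case: ifP => _; rewrite ?mule1 ?mule0 // muleC.
- apply: measurable_funS mg1 => //.
  by move=> s /=; rewrite !in_itv/= => /andP[-> sr]; rewrite (lt_trans sr).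
- move=> s /= ; rewrite in_itv/= => /andP[s0 sr]; apply: g10 => /=.
  by rewrite in_itv/= s0 (lt_trans sr).
- by apply: g20; rewrite inE in rD.
Qed.

(** The dyadic numbers up to X add up to at most 2 X. *)
Lemma dyadic_sum_le (X : R) n :
  0 <= X -> \sum_(k < n) 2 ^+ k * (if 2 ^+ k <= X then 1 else 0) <= 2 * X.
Proof.
(* The induction needs the bound 2 ^ n as well, for the levels below X. *)
move=> X0; suff: \sum_(k < n) 2 ^+ k * (if 2 ^+ k <= X then 1 else 0) <= 2 * X
   /\ \sum_(k < n) 2 ^+ k * (if 2 ^+ k <= X then 1 else 0) <= 2 ^+ n :> R by case.
elim: n => [|n [IH1 IH2]].
  by rewrite !big_ord0 expr0; split; [rewrite mulr_ge0|exact: ler01].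
rewrite !big_ord_recr/= exprS.
have p0 : 0 <= 2 ^+ n :> R by rewrite exprn_ge0.
by case: ifPn => h; split; lra.
Qed.

Lemma dyadic_exists (X : R) : 1 < X -> exists n : nat, 2 ^+ n < X <= 2 ^+ n.+1.
Proof.
move=> X1.
have [N HN] : exists N : nat, X <= 2 ^+ N.
  exists (Num.bound X); have := archi_boundP (ltW (lt_trans ltr01 X1)).
  move=> /ltW/le_trans; apply; rewrite -natrX ler_nat.
  by apply: ltnW; exact: ltn_expl.
have ex : exists n : nat, X <= 2 ^+ n by exists N.
case: (ex_minnP ex) => -[|n]; first by rewrite expr0 leNgt X1.
move=> Xn min; exists n; rewrite Xn andbT ltNge; apply/negP => /min.
by rewrite ltnn.
Qed.
End Tools.

(** * Quasi-concave weights and their Stieltjes measures *)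
Section Stieltjes.
Context {R : realType}.
Implicit Types (F : R -> R) (a b s t u : R).
Local Notation dS F := (lebesgue_stieltjes_measure (stieltjes_ext F)).

(** Nonnegative nondecreasing functions F on [0,1) such that F(t) / t is
    nonincreasing and F takes arbitrarily small values on (0,1), that is,
    F(0+) = 0. *)
Definition quasiconcave F : Prop :=
  [/\ (forall t, t \in `[0, 1[ -> 0 <= F t),
      {in `[0, 1[ &, {homo F : s t / s <= t}},
      (forall s t, 0 < s -> s <= t -> t < 1 -> s * F t <= t * F s) &
      (forall e, 0 < e -> exists2 t, 0 < t < 1 & F t < e)].

Lemma quasiconcave_weight F : quasiconcave F -> stieltjes_weight F.
Proof.
move=> [F0 Fnd Fq _]; split=> //; exists (2 * F 2^-1) => _ [t /= + <-].
rewrite in_itv/= => /andP[t0 t1].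
have h : (2^-1 : R) \in `[0, 1[ by rewrite in_itv/=; apply/andP; split; lra.
have [t2|t2] := leP t 2^-1.
  have : F t <= F 2^-1 by apply: Fnd => //; rewrite in_itv/= t0.
  by have := F0 _ h; lra.
have ht : t \in `[0, 1[ by rewrite in_itv/= t0.
have := Fq 2^-1 t; rewrite invr_gt0 ltr0n (ltW t2) t1 => /(_ erefl erefl erefl).
have : t * F 2^-1 <= 1 * F 2^-1 by rewrite ler_wpM2r ?F0// ltW.
by lra.
Qed.

Lemma stieltjes_ext_le F t s : stieltjes_weight F -> Num.max t 0 < s -> s < 1 ->
  stieltjes_ext F t <= F s.
Proof.
move=> wF ts s1; rewrite /stieltjes_ext asboolT//.
have t1 : t < 1 by rewrite (le_lt_trans _ (lt_trans ts s1))// le_max lexx.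
rewrite t1; apply: ge_inf.
  exists (F 0) => _ [r /= + <-]; rewrite in_itv/= => /andP[tr r1].
  have r0 : 0 <= r by rewrite ltW// (le_lt_trans _ tr)// le_max lexx orbT.
  by apply wF.1; rewrite ?in_itv/= ?lexx ?ltr01 ?r0.
by exists s => //=; rewrite in_itv/= ts.
Qed.

Lemma stieltjes_ext_ge F t s : stieltjes_weight F -> 0 <= s -> s < 1 -> s <= t ->
  F s <= stieltjes_ext F t.
Proof.
move=> wF s0 s1 st; rewrite /stieltjes_ext asboolT//.
have sI : s \in `[0, 1[ by rewrite in_itv/= s0.
case: ifPn => [t1|_].
  apply: lb_le_inf.
    have m1 : Num.max t 0 < 1 by rewrite gt_max t1 ltr01.
    exists (F ((Num.max t 0 + 1) / 2)), ((Num.max t 0 + 1) / 2) => //=.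
    by rewrite in_itv/=; apply/andP; split; lra.
  move=> _ [r /= + <-]; rewrite in_itv/= => /andP[tr r1].
  have tr' : t < r by rewrite (le_lt_trans _ tr)// le_max lexx.
  apply wF.1 => //; last by rewrite (le_trans st)// ltW.
  by rewrite in_itv/= r1 (le_trans s0)// (le_trans st)// ltW.
by apply: ub_le_sup; [case: wF|exists s].
Qed.

Lemma stieltjes_ext1_le F B : stieltjes_weight F ->
  (forall s, 0 <= s < 1 -> F s <= B) -> stieltjes_ext F 1 <= B.
Proof.
move=> wF FB; rewrite /stieltjes_ext asboolT// ltxx.
apply: ge_sup; first by exists (F 0), 0 => //=; rewrite in_itv/= lexx ltr01.
by move=> _ [s /= + <-]; rewrite in_itv/=; exact: FB.
Qed.

Lemma stieltjes_measure_itv_oc F a b : a <= b ->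
  dS F `]a, b]%classic = (stieltjes_ext F b - stieltjes_ext F a)%:E.
Proof.
move=> ab; rewrite /lebesgue_stieltjes_measure /measure_extension.
rewrite measurable_mu_extE/=; last exact: is_ocitv.
by rewrite wlength_itv_bnd.
Qed.

Variable F : R -> R.
Hypothesis qF : quasiconcave F.
Let wF := quasiconcave_weight qF.

Lemma stieltjes_ext0 : stieltjes_ext F 0 = 0.
Proof.
have [F0 _ _ Fs] := qF.
apply/eqP; rewrite eq_le; apply/andP; split; last first.
  have I0 : (0 : R) \in `[0, 1[ by rewrite in_itv/= lexx ltr01.
  by rewrite (le_trans (F0 _ I0))// stieltjes_ext_ge.
apply/ler_addgt0Pr => e e0; rewrite add0r.
have [t /andP[t0 t1] Ft] := Fs _ e0.
by rewrite (le_trans _ (ltW Ft))// stieltjes_ext_le// maxxx.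
Qed.

(** For a quasi-concave F the Stieltjes measure of ]0,a[ is exactly F(a) when
    0 < a < 1; this lemma and the next one are the two inequalities. *)
Lemma stieltjes_measure_oo_le a : 0 <= a -> a < 1 ->
  (dS F `]0%R, a[%classic <= (F a)%:E)%E.
Proof.
move=> a0 a1; have [F0 Fnd Fq Fs] := qF.
have aI : a \in `[0, 1[ by rewrite in_itv/= a0.
move: a0; rewrite le_eqVlt => /predU1P[<-|a0].
  rewrite set_itv_ge ?bnd_simp// measure0 lee_fin F0//.
  by rewrite in_itv/= lexx ltr01.
apply: (@le_trans _ _ (dS F `]0%R, a]%classic)).
  apply: le_measure; rewrite ?inE; try exact: measurable_itv.
  by move=> x /=; rewrite !in_itv/= => /andP[-> /ltW].
rewrite stieltjes_measure_itv_oc ?(ltW a0)// stieltjes_ext0 subr0 lee_fin.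
apply/ler_addgt0Pr => e e0.
have Fa := F0 _ aI.
(* F (a + d) <= (1 + d / a) F a, and d is chosen so that d F a <= e a. *)
pose d := Num.min ((1 - a) / 2) (e * a / (F a + 1)).
have d0 : 0 < d.
  by rewrite lt_min !divr_gt0 ?mulr_gt0 ?subr_gt0// ltr_wpDl.
have d1 : d <= (1 - a) / 2 by rewrite ge_min lexx.
have d2 : d * (F a + 1) <= e * a.
  by rewrite -ler_pdivlMr ?ltr_wpDl// ge_min lexx orbT.
apply: (@le_trans _ _ (F (a + d))).
  apply: stieltjes_ext_le => //; last by lra.
  by rewrite gt_max; apply/andP; split; lra.
have ad1 : a + d < 1 by lra.
have ad : a <= a + d by lra.
have := Fq _ _ a0 ad ad1.
move=> h; rewrite -(ler_pM2l a0); apply: (le_trans h).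
by move: d2; rewrite !mulrDl !mulrDr; lra.
Qed.

Lemma stieltjes_measure_oo_ge a : 0 < a -> a < 1 ->
  ((F a)%:E <= dS F `]0%R, a[%classic)%E.
Proof.
move=> a0 a1; have [F0 Fnd Fq Fs] := qF.
have aI : a \in `[0, 1[ by rewrite in_itv/= (ltW a0).
have Fa := F0 _ aI.
apply/lee_addgt0Pr => e e0.
pose d := Num.min (a / 2) (e * a / (F a + 1)).
have d0 : 0 < d.
  by rewrite lt_min !divr_gt0 ?mulr_gt0 ?subr_gt0// ltr_wpDl.
have d1 : d <= a / 2 by rewrite ge_min lexx.
have d2 : d * (F a + 1) <= e * a.
  by rewrite -ler_pdivlMr ?ltr_wpDl// ge_min lexx orbT.
apply: (@le_trans _ _ (dS F `]0%R, (a - d)%R]%classic + e%:E)%E); last first.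
  apply: leeD => //; apply: le_measure; rewrite ?inE; try exact: measurable_itv.
  move=> x /=; rewrite !in_itv/= => /andP[-> /le_lt_trans]; apply; lra.
have ad : a - d <= a by lra.
have ad0 : 0 < a - d by lra.
rewrite stieltjes_measure_itv_oc ?(ltW ad0)// stieltjes_ext0 subr0 lee_fin.
have h1 : F (a - d) <= stieltjes_ext F (a - d).
  by apply: stieltjes_ext_ge => //; lra.
apply: (@le_trans _ _ (F (a - d) + e)); last by rewrite lerD2r.
have h := Fq _ _ ad0 ad a1.
rewrite -(ler_pM2l a0) mulrDr.
by move: h d2; rewrite !mulrDl !mulrDr !mulNr; lra.
Qed.

Lemma stieltjes_measure_01_le B : (forall s, 0 <= s < 1 -> F s <= B) ->
  (dS F `]0%R, 1%R[%classic <= B%:E)%E.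
Proof.
move=> FB; apply: (@le_trans _ _ (dS F `]0%R, 1%R]%classic)).
  apply: le_measure; rewrite ?inE; try exact: measurable_itv.
  by move=> x /=; rewrite !in_itv/= => /andP[-> /ltW].
by rewrite stieltjes_measure_itv_oc// stieltjes_ext0 subr0 lee_fin stieltjes_ext1_le.
Qed.

Lemma le_stieltjes_measure_oo a b : a <= b ->
  (dS F `]0%R, a[%classic <= dS F `]0%R, b[%classic)%E.
Proof.
move=> ab; apply: le_measure; rewrite ?inE; try exact: measurable_itv.
by move=> x /=; rewrite !in_itv/= => /andP[-> /lt_le_trans]; exact.
Qed.

Lemma stieltjes_measure_01_ge a : 0 < a -> a < 1 ->
  ((F a)%:E <= dS F `]0%R, 1%R[%classic)%E.
Proof.
move=> a0 a1; apply: (le_trans (stieltjes_measure_oo_ge a0 a1)).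
by apply: le_stieltjes_measure_oo; exact: ltW.
Qed.

Lemma stieltjes_measure_fin a : a <= 1 -> dS F `]0%R, a[%classic \is a fin_num.
Proof.
move=> a1; rewrite ge0_fin_numE//.
apply: (le_lt_trans (le_stieltjes_measure_oo a1)).
have [_ [M HM]] := wF.
apply: (@le_lt_trans _ _ M%:E); last exact: ltry.
by apply: stieltjes_measure_01_le => s s01; apply: HM; exists s => //=; rewrite in_itv.
Qed.

End Stieltjes.

Section Psi.
Context {R : realType}.
Variable phi : R -> R.
Implicit Types (a b s t u w v : R).
Hypothesis phi01 : forall t : R, t \in `[0, 1[ -> 0 <= phi t < 1.
Hypothesis phi_incr : {in `[0, 1[ &, {homo phi : s t / s <= t}}.
Hypothesis phi_neq0 : exists2 t : R, t \in `]0, 1[ & phi t != 0.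
Hypothesis phi_concave : concave01 phi.
Hypothesis phi0 : phi t @[t --> 0^'+] --> (0 : R).

Lemma concave_quasiconcave : quasiconcave phi.
Proof.
split=> //.
- by move=> t /phi01/andP[].
- move=> s t s0 st t1; have t0 : 0 < t by exact: lt_le_trans st.
  have I0 : (0 : R) \in `[0, 1[ by rewrite in_itv/= lexx ltr01.
  have It : t \in `[0, 1[ by rewrite in_itv/= t1 ltW.
  have Ia : s / t \in `[0, 1].
    by rewrite in_itv/= ler_pdivrMr// mul1r st andbT divr_ge0 ?ltW.
  have := phi_concave It I0 Ia.
  rewrite mulr0 addr0 divfK ?gt_eqF// => h.
  have {}h : s / t * phi t <= phi s.
    apply: le_trans h; rewrite lerDl mulr_ge0//.
      by rewrite subr_ge0; move: Ia; rewrite in_itv/= => /andP[].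
    by have /andP[] := phi01 I0.
  by rewrite -ler_pdivrMl// mulrA [_^-1 * _]mulrC.
- move=> e e0.
  have H : \forall t \near 0^'+, phi t < e.
    move/cvgrPdist_lt: phi0 => /(_ _ e0); apply: filterS => t.
    by rewrite sub0r normrN; apply: le_lt_trans; exact: ler_norm.
  near (0:R)^'+ => t; exists t; last by near: t.
  by apply/andP; split; near: t; [exact: nbhs_right_gt|exact: nbhs_right_lt].
Unshelve. all: end_near.
Qed.
Let qphi := concave_quasiconcave.

Lemma concave01_gt0 t : 0 < t -> t < 1 -> 0 < phi t.
Proof.
move=> t0 t1; have [f0 fnd fq fs] := qphi.
case: phi_neq0 => u; rewrite in_itv/= => /andP[u0 u1] pu.
have iu : u \in `[0, 1[ by rewrite in_itv/= ltW.
have it : t \in `[0, 1[ by rewrite in_itv/= ltW.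
have pu0 : 0 < phi u by rewrite lt_neqAle eq_sym pu f0.
have [ut|tu] := leP u t; first by rewrite (lt_le_trans pu0)// fnd.
have := fq _ _ t0 (ltW tu) u1.
move=> h; have : 0 < u * phi t by rewrite (lt_le_trans _ h)// mulr_gt0.
by rewrite pmulr_rgt0.
Qed.

Lemma ln_le_subr1 (x : R) : 0 < x -> ln x <= x - 1.
Proof.
move=> x0; have := @le_ln1Dx R (x - 1); rewrite addrCA subrr addr0; apply.
by rewrite ltrBrDr addNr.
Qed.

Lemma psi_of_le u w : 0 <= u -> 1 < w -> u * w < 1 ->
  psi_of phi u * (1 + ln w) <= phi (u * w).
Proof.
move=> u0 w1 uw1; have l0 := ln_gt0 w1.
rewrite -ler_pdivlMr ?addr_gt0//; apply: ge_inf; last by exists w.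
exists 0 => _ [v /= [v1 uv1] <-].
have lv := ln_gt0 v1.
rewrite divr_ge0//; last by rewrite addr_ge0// ltW.
have /phi01/andP[] // : u * v \in `[0, 1[.
by rewrite in_itv/= uv1 mulr_ge0// ltW// (lt_trans _ v1).
Qed.

Lemma psi_of_ge u y : 0 <= u -> u < 1 ->
  (forall w, 1 < w -> u * w < 1 -> y * (1 + ln w) <= phi (u * w)) ->
  y <= psi_of phi u.
Proof.
move=> u0 u1 H; apply: lb_le_inf.
  exists (phi (u * (2 / (1 + u))) / (1 + ln (2 / (1 + u)))), (2 / (1 + u)) => //=.
  by rewrite mulrA ltr_pdivlMr ?ltr_pdivrMr; [split|..]; lra.
move=> _ [w /= [w1 uw1] <-].
by rewrite ler_pdivlMr ?H// addr_gt0// ln_gt0.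
Qed.

(** As phi(u w) <= w phi(u), letting w tend to 1 in the infimum gives the
    bound. *)
Lemma psi_of_le_phi u : 0 < u -> u < 1 -> psi_of phi u <= phi u.
Proof.
move=> u0 u1; have [f0 fnd fq fs] := qphi.
apply/ler_addgt0Pr => e e0.
have iu : u \in `[0, 1[ by rewrite in_itv/= ltW.
have pu0 := concave01_gt0 u0 u1.
pose d := Num.min ((1 - u) / (u * 2)) (e / phi u).
have d0 : 0 < d by rewrite lt_min !divr_gt0 ?mulr_gt0 ?subr_gt0.
have d1 : u * d <= (1 - u) / 2.
  rewrite mulrC -ler_pdivlMr// -mulrA -invfM [2 * u]mulrC.
  by rewrite /d ge_min lexx.
have d2 : d * phi u <= e.
  by rewrite -ler_pdivlMr// ge_min lexx orbT.
have uw : u * (1 + d) < 1 by rewrite mulrDr mulr1; lra.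
have w1 : 1 < 1 + d by lra.
have h1 := psi_of_le (ltW u0) w1 uw.
have ud : u <= u * (1 + d) by rewrite ler_peMr ?(ltW u0)// ltW.
have h2 := fq _ _ u0 ud uw.
have h3 : phi (u * (1 + d)) <= (1 + d) * phi u.
  by rewrite -(ler_pM2l u0) mulrA.
have l0 := ln_gt0 w1.
have p0 : 0 <= psi_of phi u.
  apply: psi_of_ge (ltW u0) u1 _ => w _w1 uw1; rewrite mul0r.
  by apply: f0; rewrite in_itv/= uw1 mulr_ge0 ?(ltW u0)// ltW// (lt_trans _ _w1).
have h4 : psi_of phi u <= psi_of phi u * (1 + ln (1 + d)).
  by rewrite ler_peMr// lerDl ltW.
by apply: (le_trans h4); apply: (le_trans h1); apply: (le_trans h3); lra.
Qed.

(** On the range 1 < w < 1 / u one has 1 + ln w <= w < 1 / u. *)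
Lemma psi_of_ge_phi u : 0 < u -> u < 1 -> u * phi u <= psi_of phi u.
Proof.
move=> u0 u1; have [f0 fnd fq fs] := qphi.
have pu0 := concave01_gt0 u0 u1.
apply: psi_of_ge => // [|w w1 uw1]; first exact: ltW.
have w0 : 0 < w by exact: lt_trans w1.
have h : phi u <= phi (u * w).
  apply: fnd; rewrite ?in_itv/= ?(ltW u0)//=.
    by rewrite uw1 mulr_ge0 ?ltW.
  by rewrite ler_peMr ?ltW.
apply: le_trans h; rewrite mulrAC ler_piMl ?(ltW pu0)//.
have := ln_le_subr1 w0 => lw.
apply: (@le_trans _ _ (u * w)); last exact: ltW.
by rewrite ler_pM2l//; lra.
Qed.

Lemma psi_of_gt0 u : 0 < u -> u < 1 -> 0 < psi_of phi u.
Proof.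
by move=> u0 u1; rewrite (lt_le_trans _ (psi_of_ge_phi u0 u1))// mulr_gt0// concave01_gt0.
Qed.

(** For s <= t, a competitor w for psi(s) yields the competitor s w / t for
    psi(t) when s w > t; otherwise psi(t) <= phi(t) is enough. *)
Lemma psi_of_quasiconcave : quasiconcave (psi_of phi).
Proof.
have [f0 fnd fq fs] := qphi.
have p0 t : t \in `[0, 1[ -> 0 <= psi_of phi t.
  rewrite in_itv/= => /andP[t0 t1]; apply: psi_of_ge => // w w1 uw1.
  by rewrite mul0r f0// in_itv/= uw1 mulr_ge0// ltW// (lt_trans _ w1).
split=> //.
- exact: (psi_of_weight phi01 phi_incr).1.
- move=> s t s0 st t1; have t0 : 0 < t by exact: lt_le_trans st.
  have s1 : s < 1 by exact: le_lt_trans t1.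
  rewrite mulrC -ler_pdivrMl//; apply: psi_of_ge => // [|w w1 sw1].
    exact: ltW.
  have w0 : 0 < w by exact: lt_trans w1.
  have sw0 : 0 < s * w by rewrite mulr_gt0.
  have l0 := ln_gt0 w1.
  have it : t \in `[0, 1[ by rewrite in_itv/= ltW.
  have pt := p0 _ it.
  rewrite -(ler_pM2l t0) !mulrA mulfV ?gt_eqF// mul1r.
  have [swt|tsw] := leP (s * w) t.
    have h := fq _ _ sw0 swt t1.
    apply: le_trans h.
    have h1 := psi_of_le_phi t0 t1.
    have h2 := ln_le_subr1 w0.
    have -> : psi_of phi t * s * (1 + ln w) = s * (1 + ln w) * psi_of phi t by ring.
    apply: ler_pM => //; first by rewrite mulr_ge0 ?addr_ge0// ltW.
    by rewrite ler_pM2l//; lra.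
  have w'1 : 1 < s * w / t by rewrite ltr_pdivlMr// mul1r.
  have tw' : t * (s * w / t) = s * w by rewrite mulrC divfK// gt_eqF.
  have := psi_of_le (ltW t0) w'1; rewrite tw' => /(_ sw1) h.
  have -> : ln w = ln (s * w / t) + ln (t / s).
    rewrite -lnM ?posrE ?divr_gt0//; congr ln.
    by field; rewrite !gt_eqF.
  have h2 : ln (t / s) <= t / s - 1 by apply: ln_le_subr1; rewrite divr_gt0.
  have {}h2 : s * ln (t / s) <= t - s.
    have := h2; rewrite -(ler_pM2l s0) mulrBr mulr1 mulrCA mulfV ?gt_eqF//.
    by rewrite mulr1.
  have l1 := ln_gt0 w'1.
  apply: (@le_trans _ _ (t * (psi_of phi t * (1 + ln (s * w / t))))); last first.
    by rewrite ler_pM2l.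
  rewrite mulrCA -mulrA ler_wpM2l//.
  have : s * ln (s * w / t) <= t * ln (s * w / t) by rewrite ler_pM2r.
  by rewrite !mulrDr !mulr1; lra.
- move=> e e0; have [t /andP[t0 t1] pt] := fs _ e0.
  by exists t; rewrite ?t0// (le_lt_trans (psi_of_le_phi t0 t1)).
Qed.

End Psi.

(** * Distribution functions and rearrangements *)
Section Rearrangement.
Context {R : realType}.
Implicit Types (x F : R -> R) (s t u l : R).
Local Notation RR := (measurableTypeR R).
Local Notation I01 := (`]0, 1[%classic : set R).
Local Notation leb := (@lebesgue_measure R).
Local Notation dS F := (lebesgue_stieltjes_measure (stieltjes_ext F)).

(** The distribution function of |x| on (0,1). It takes extended real values
    as a measure does, but is at most 1 for measurable x. *)
Definition distribution x s : \bar R :=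
  leb [set u | (0 < u < 1)%R /\ (s < `|x u|)%R].

Lemma superlevelE x s :
  [set u | (0 < u < 1)%R /\ (s < `|x u|)%R] =
  I01 `&` (fun u => `|x u|) @^-1` `]s, +oo[%classic.
Proof.
by apply/seteqP; split=> u /=; rewrite !in_itv/= andbT.
Qed.

Lemma measurable_superlevel x s : measurable_fun I01 x ->
  measurable [set u | (0 < u < 1)%R /\ (s < `|x u|)%R].
Proof.
move=> mx; rewrite superlevelE.
have mn : measurable_fun I01 (fun u => `|x u|).
  by apply: measurableT_comp => //; exact: measurable_normr.
by apply: mn => //; exact: measurable_itv.
Qed.

Lemma distribution_le1 x s : measurable_fun I01 x -> (distribution x s <= 1)%E.
Proof.
move=> mx; apply: (@le_trans _ _ (leb I01)).
  apply: le_measure; rewrite ?inE; [exact: measurable_superlevel|exact: measurable_itv|].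
  by move=> u /= [u01 _]; rewrite in_itv.
by rewrite lebesgue_measure_itv/= lte_fin ltr01 sube0.
Qed.

Lemma distribution_fin x s : measurable_fun I01 x ->
  distribution x s \is a fin_num.
Proof.
by move=> mx; rewrite ge0_fin_numE// (le_lt_trans (distribution_le1 s mx))// ltry.
Qed.

(** The set whose infimum defines the rearrangement at t > 0 is nonempty. *)
Lemma distribution_cvg0 x t : measurable_fun I01 x -> 0 < t ->
  exists2 s, 0 <= s & (distribution x s <= t%:E)%E.
Proof.
move=> mx t0; pose E (n : nat) : set RR := [set u | (0 < u < 1)%R /\ (n%:R < `|x u|)%R].
have cE : bigcap setT E = set0.
  apply/seteqP; split=> // u /= Eu.
  have [_] := Eu (Num.bound `|x u|) I.
  by rewrite ltNge ltW// archi_boundP.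
have := @nonincreasing_cvg_mu _ _ _ leb E.
rewrite cE measure0 => H.
have {H} : (leb \o E) n @[n --> \oo] --> 0%E.
  apply: H.
  - by apply: (le_lt_trans (distribution_le1 0 mx)); exact: ltry.
  - by move=> i; exact: measurable_superlevel.
  - exact: measurable0.
  - move=> n m nm; apply/subsetPset => u /= [u01 h]; split=> //.
    by apply: le_lt_trans h; rewrite ler_nat.
move=> /fine_cvgP[_ /cvgrPdist_le /(_ _ t0) [n _ /(_ n (leqnn n))]] /=.
rewrite sub0r normrN => h; exists n%:R => //.
rewrite -(fineK (distribution_fin n%:R mx)) lee_fin.
by apply: le_trans h; exact: ler_norm.
Qed.

Lemma rearrangement_ge0 x t : 0 <= rearrangement x t.
Proof.
rewrite /rearrangement; set A := [set s | _].
have [A0|/nonemptyPn A0] := pselect (A !=set0).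
  by apply: lb_le_inf => // s [].
by rewrite A0 inf0.
Qed.

Lemma rearrangement_le x t s : 0 <= s -> (distribution x s <= t%:E)%E ->
  rearrangement x t <= s.
Proof. by move=> s0 h; apply: ge_inf => //; exists 0 => r []. Qed.

Lemma rearrangement_gt x t s : 0 <= s -> s < rearrangement x t ->
  (t%:E < distribution x s)%E.
Proof.
by move=> s0; rewrite ltNge; apply: contraNlt; exact: rearrangement_le.
Qed.

Lemma le_distribution x s s' : measurable_fun I01 x -> s <= s' ->
  (distribution x s' <= distribution x s)%E.
Proof.
move=> mx ss'; apply: le_measure; rewrite ?inE; try exact: measurable_superlevel.
by move=> u /= [u01 h]; split=> //; exact: le_lt_trans h.
Qed.

Lemma rearrangement_ge x t s : measurable_fun I01 x -> 0 < t ->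
  (t%:E < distribution x s)%E -> s <= rearrangement x t.
Proof.
move=> mx t0 h; apply: lb_le_inf.
  by have [r r0 hr] := distribution_cvg0 mx t0; exists r.
move=> r [r0 hr]; rewrite leNgt; apply/negP => rs.
have := lt_le_trans h (le_distribution mx (ltW rs)).
by rewrite ltNge hr.
Qed.

Lemma rearrangement_nonincreasing x s t : measurable_fun I01 x ->
  0 < s -> s <= t -> rearrangement x t <= rearrangement x s.
Proof.
move=> mx s0 st; apply: lb_le_inf.
  by have [r r0 hr] := distribution_cvg0 mx s0; exists r.
move=> r [r0 hr]; apply: rearrangement_le => //.
by apply: (le_trans hr); rewrite lee_fin.
Qed.

Lemma measurable_rearrangement x : measurable_fun I01 x ->
  measurable_fun I01 (rearrangement x).
Proof.
move=> mx; apply/measurable_EFinP; apply: nonincreasing_emeasurable.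
  exact: interval_is_interval.
move=> s t /=; rewrite !in_itv/= => /andP[s0 s1] _ st.
by rewrite lee_fin rearrangement_nonincreasing.
Qed.

(** A nonincreasing majorant of |x| also majorizes the rearrangement; in
    particular rearranging a nonincreasing function does not increase it. *)
Lemma rearrangement_le_nonincreasing x (G : R -> \bar R) t :
  measurable_fun I01 x ->
  (forall u, 0 < u < 1 -> ((`|x u|)%:E <= G u)%E) ->
  (forall u v, 0 < u -> u <= v -> v < 1 -> (G v <= G u)%E) ->
  0 < t < 1 -> ((rearrangement x t)%:E <= G t)%E.
Proof.
move=> mx xG G_ni t01; have /andP[t0 t1] := t01.
have xG' u : t <= u -> u < 1 -> ((`|x u|)%:E <= G t)%E.
  move=> tu u1; apply: le_trans (G_ni _ _ t0 tu u1); apply: xG.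
  by rewrite u1 andbT (lt_le_trans t0).
have := xG' t (lexx t) t1; case: (G t) xG' => [g| |//] xG' xt; last by rewrite leey.
rewrite lee_fin; apply: rearrangement_le.
  by move: xt; rewrite lee_fin; exact: le_trans.
apply: (@le_trans _ _ (leb `]0, t[%classic)).
  apply: le_measure; rewrite ?inE; [exact: measurable_superlevel|exact: measurable_itv|].
  move=> u /= [/andP[u0 u1] h]; rewrite in_itv/= u0 ltNge; apply/negP => tu.
  by have := xG' _ tu u1; rewrite lee_fin leNgt h.
by rewrite lebesgue_measure_itv/= lte_fin t0 sube0.
Qed.

(** The dyadic form of the layer-cake formula: at each point s, the levels
    2^k d that the rearrangement of x reaches add up to at most twice its
    value. *)
Lemma dyadic_distribution_le F x (d : R) : measurable_fun I01 x -> 0 < d ->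
  (\sum_(0 <= k <oo) ((2 ^+ k.+1 * d)%:E *
     dS F `]0%R, (fine (distribution x (2 ^+ k * d)))[%classic)
   <= 4%:E * lorentz_norm F x)%E.
Proof.
move=> mx d0.
pose h (k : nat) (s : R) : \bar R :=
  if (2 ^+ k * d <= rearrangement x s)%R then (2 ^+ k.+1 * d)%:E else 0%E.
have p0 (k : nat) : 0 <= 2 ^+ k * d by rewrite mulr_ge0 ?exprn_ge0// ltW.
have h0 k s : (0 <= h k s)%E.
  by rewrite /h; case: ifP => _; rewrite ?lee_fin// mulr_ge0 ?exprn_ge0// ltW.
have mD : measurable I01 by exact: measurable_itv.
have mh k : measurable_fun I01 (h k).
  apply: nonincreasing_emeasurable; first exact: interval_is_interval.
  move=> s t /=; rewrite !in_itv/= => /andP[s0 s1] _ st; rewrite /h.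
  have := rearrangement_nonincreasing mx s0 st.
  case: ifPn => [a1 /(le_trans a1) ->//|_ _].
  by case: ifP => _; rewrite ?lee_fin// mulr_ge0 ?exprn_ge0// ltW.
apply: (@le_trans _ _ (\sum_(0 <= k <oo) \int[dS F]_(s in I01) h k s)%E).
  apply: lee_nneseries => [k _ _|k _].
    by rewrite mule_ge0// lee_fin mulr_ge0 ?exprn_ge0// ltW.
  set u := fine _.
  have u1 : u <= 1.
    by rewrite -lee_fin fineK ?distribution_fin// distribution_le1.
  rewrite -integral_cst; last exact: measurable_itv.
  apply: (@le_trans _ _ (\int[dS F]_(s in `]0%R, u[) h k s)%E); last first.
    apply: ge0_subset_integral; [exact: measurable_itv|exact: mD|exact: mh|by []|].
    by move=> s /=; rewrite !in_itv/= => /andP[-> /lt_le_trans]; exact.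
  rewrite le_eqVlt; apply/orP; left; apply/eqP/eq_integral => s.
  rewrite inE/= in_itv/= => /andP[s0 su]; rewrite /h.
  rewrite ifT//; apply: rearrangement_ge => //.
  by rewrite -lte_fin fineK ?distribution_fin// in su.
rewrite -integral_nneseries// -ge0_integralZl//; last 2 first.
- by apply/measurable_EFinP; exact: measurable_rearrangement.
- by move=> s _; rewrite lee_fin rearrangement_ge0.
apply: ge0_le_integral => //.
- by move=> s _; apply: nneseries_ge0 => *.
- by apply: (@ge0_emeasurable_sum _ _ _ _ h xpredT).
- apply/measurable_funeM/measurable_EFinP; exact: measurable_rearrangement.
move=> s _; apply: lime_le; first exact: is_cvg_nneseries.
apply: nearW => n; rewrite -EFinM.
rewrite [leLHS](_ : _ = (\sum_(0 <= k < n) 2 * d * (2 ^+ k *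
    (if 2 ^+ k <= rearrangement x s / d then 1 else 0)))%:E); last first.
  rewrite -sumEFin; apply: eq_bigr => k _; rewrite /h ler_pdivlMr//.
  case: ifP => _; last by rewrite !mulr0.
  by congr (_%:E); rewrite mulr1 exprS; ring.
rewrite lee_fin -mulr_sumr big_mkord.
have := @dyadic_sum_le R (rearrangement x s / d) n.
rewrite divr_ge0 ?rearrangement_ge0 ?(ltW d0)// => /(_ erefl).
rewrite -(ler_pM2l (mulr_gt0 (ltr0n R 2) d0)) => /le_trans; apply.
by rewrite le_eqVlt; apply/orP; left; apply/eqP; field; rewrite gt_eqF.
Qed.

End Rearrangement.

(** * Embeddings of a Lorentz space into weighted L1 spaces *)
Section Dominance.
Context {R : realType}.
Implicit Types (x F : R -> R) (s t u l : R).
Local Notation RR := (measurableTypeR R).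
Local Notation I01 := (`]0, 1[%classic : set R).
Local Notation leb := (@lebesgue_measure R).
Local Notation dS F := (lebesgue_stieltjes_measure (stieltjes_ext F)).

(** |x| is at most d plus the sum of 2^(k+1) d over the levels 2^k d that it
    exceeds; the hypothesis on k bounds the contribution of each level, and d
    tends to 0. *)
Lemma integral_lorentz_le F x (k : R -> \bar R) (C : R) :
  quasiconcave F -> measurable_fun I01 x -> 0 <= C ->
  (forall s, I01 s -> (0 <= k s)%E) -> measurable_fun I01 k ->
  (forall E : set R, measurable E -> E `<=` I01 ->
    (\int[leb]_(s in E) k s <=
     C%:E * dS F `]0%R, (fine (leb E))[%classic)%E) ->
  (\int[leb]_(s in I01) (`|x s|%:E * k s) <= (4 * C)%:E * lorentz_norm F x)%E.
Proof.
move=> qF mx C0 k0 mk HE.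
have mD : measurable I01 by exact: measurable_itv.
have mxn : measurable_fun I01 (fun s => (`|x s|)%:E).
  by apply/measurable_EFinP; apply: measurableT_comp => //; exact: measurable_normr.
have N0 : (0 <= lorentz_norm F x)%E.
  by apply: integral_ge0 => s _; rewrite lee_fin rearrangement_ge0.
set K := (C%:E * dS F `]0%R, (fine (leb I01))[%classic)%E.
have Kfin : K \is a fin_num.
  rewrite fin_numM// stieltjes_measure_fin//.
  rewrite lebesgue_measure_itv/= lte_fin ltr01 sube0/=; exact: lexx.
have HK : (\int[leb]_(s in I01) k s <= K)%E by exact: HE.
have K0 : (0 <= K)%E by rewrite mule_ge0// lee_fin.
suff H (d : R) : 0 < d -> (\int[leb]_(s in I01) (`|x s|%:E * k s) <=
    (4 * C)%:E * lorentz_norm F x + d%:E * K)%E.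
  apply/lee_addgt0Pr => e e0.
  have K1 : 0 < fine K + 1 by rewrite ltr_wpDl// fine_ge0.
  apply: (le_trans (H (e / (fine K + 1)) _)); first by rewrite divr_gt0.
  apply: leeD => //; rewrite -(fineK Kfin) -EFinM lee_fin.
  rewrite mulrAC ler_pdivrMr// ler_pM2l//.
  by rewrite fineK// lerDl.
move=> d0; pose E (n : nat) := [set u | (0 < u < 1)%R /\ (2 ^+ n * d < `|x u|)%R].
have p0 (n : nat) : 0 <= 2 ^+ n * d by rewrite mulr_ge0 ?exprn_ge0// ltW.
have mE n : measurable (E n) by exact: measurable_superlevel.
have ED n : E n `<=` I01 by move=> u [u01 _] /=; rewrite in_itv.
pose g (n : nat) s := ((2 ^+ n.+1 * d)%:E * (k \_ (E n)) s)%E.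
have kE0 n s : I01 s -> (0 <= (k \_ (E n)) s)%E.
  by move=> Ds; rewrite patchE; case: ifP => // _; exact: k0.
have g0 n s : I01 s -> (0 <= g n s)%E.
  by move=> Ds; rewrite mule_ge0 ?kE0// lee_fin.
have mkE n : measurable_fun I01 (k \_ (E n)).
  apply/measurable_restrict => //.
  by apply: measurable_funS mk => //; exact: subIsetr.
have mg n : measurable_fun I01 (g n) by exact: measurable_funeM.
have mS : measurable_fun I01 (fun s => \sum_(0 <= n <oo) g n s)%E.
  by apply: (@ge0_emeasurable_sum _ _ _ _ g xpredT) => // n s Ds _; exact: g0.
apply: (@le_trans _ _ (\int[leb]_(s in I01) (\sum_(0 <= n <oo) g n s + d%:E * k s))%E).
  apply: ge0_le_integral => //.
  - by move=> s Ds; rewrite mule_ge0// ?lee_fin// k0.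
  - exact: emeasurable_funM.
  - by apply: emeasurable_funD => //; exact: measurable_funeM.
  move=> s Ds; have S0 : (0 <= \sum_(0 <= n <oo) g n s)%E.
    by apply: nneseries_ge0 => n _ _; exact: g0.
  have [xd|dx] := leP (`|x s| / d) 1.
    rewrite -[leLHS]add0e leeD//; apply: lee_wpmul2r; first exact: k0.
    by move: xd; rewrite ler_pdivrMr// mul1r lee_fin.
  have [n /andP[n1 n2]] := dyadic_exists dx.
  apply: (@le_trans _ _ (\sum_(0 <= n <oo) g n s)%E); last first.
    by rewrite leeDl// mule_ge0 ?k0// lee_fin ltW.
  apply: (@le_trans _ _ (g n s)); last first.
    apply: le_trans (@nneseries_lim_ge _ (g^~ s) xpredT 0 n.+1 _).
      rewrite big_nat_recr//= leeDr// sume_ge0// => i _; exact: g0.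
    by move=> i _ _; exact: g0.
  rewrite /g patchE ifT; last first.
    rewrite inE/=; split; first by move: Ds; rewrite /= in_itv.
    by rewrite -ltr_pdivlMr.
  apply: lee_wpmul2r; first exact: k0.
  by rewrite lee_fin -ler_pdivrMr.
rewrite ge0_integralD//; last 3 first.
- by move=> s Ds; apply: nneseries_ge0 => n _ _; exact: g0.
- by move=> s Ds; rewrite mule_ge0 ?k0// lee_fin ltW.
- exact: measurable_funeM.
apply: leeD; last first.
  rewrite ge0_integralZl//; last by rewrite lee_fin ltW.
  by rewrite lee_wpmul2l// lee_fin ltW.
rewrite integral_nneseries//.
apply: (@le_trans _ _ (C%:E * (4%:E * lorentz_norm F x))%E); last first.
  by rewrite muleA -EFinM mulrC.
apply: (@le_trans _ _ (C%:E * \sum_(0 <= k <oo) ((2 ^+ k.+1 * d)%:E *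
     dS F `]0%R, (fine (distribution x (2 ^+ k * d)))[%classic))%E); last first.
  by apply: lee_wpmul2l; rewrite ?lee_fin//; exact: dyadic_distribution_le.
rewrite -nneseriesZl; last by move=> n _; rewrite mule_ge0// lee_fin.
apply: lee_nneseries => [n _ _|n _].
  by apply: integral_ge0 => s Ds; exact: g0.
rewrite ge0_integralZl//; [|exact: mkE|exact: kE0|by rewrite lee_fin].
rewrite muleCA lee_wpmul2l// ?lee_fin//.
rewrite -integral_mkcondr (_ : I01 `&` E n = E n); last by apply/setIidr.
exact: HE.
Qed.

Lemma lorentz_norm_ge0 F x : (0 <= lorentz_norm F x)%E.
Proof. by apply: integral_ge0 => s _; rewrite lee_fin rearrangement_ge0. Qed.

Lemma lebesgue_measure_sub01 (E : set R) : measurable E -> E `<=` I01 ->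
  (leb E <= 1)%E /\ leb E \is a fin_num.
Proof.
move=> mE ED; have h : (leb E <= 1)%E.
  have -> : (1 = leb I01)%E by rewrite lebesgue_measure_itv/= lte_fin ltr01 sube0.
  by apply: le_measure; rewrite ?inE//; exact: measurable_itv.
by split=> //; rewrite ge0_fin_numE// (le_lt_trans h)// ltry.
Qed.

Lemma stieltjes_measure_ge_linear F a t : quasiconcave F -> 0 < t -> t < 1 ->
  0 <= a <= 1 -> ((a * F t)%:E <= dS F `]0%R, a[%classic)%E.
Proof.
move=> qF t0 t1 /andP[a0 a1]; have [F0 Fnd Fq Fs] := qF.
have it : t \in `[0, 1[ by rewrite in_itv/= ltW.
have Ft := F0 _ it.
move: a0; rewrite le_eqVlt => /predU1P[<-|a0].
  by rewrite mul0r.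
have [ta|at_] := leP t a.
  apply: (@le_trans _ _ (dS F `]0%R, t[%classic)).
    apply: le_trans (stieltjes_measure_oo_ge qF t0 t1).
    by rewrite lee_fin ler_piMl.
  exact: le_stieltjes_measure_oo.
apply: le_trans (stieltjes_measure_oo_ge qF a0 (lt_trans at_ t1)).
rewrite lee_fin; apply: (le_trans (Fq _ _ a0 (ltW at_) t1)).
rewrite ler_piMl ?(ltW t1)// F0// in_itv/= (ltW a0); exact: lt_trans t1.
Qed.

(** The case k = 1, as F(a) >= a F(t) for all a. *)
Lemma lorentz_L1_le F x t : quasiconcave F -> 0 < t -> t < 1 -> 0 < F t ->
  measurable_fun I01 x ->
  (\int[leb]_(s in I01) `|x s|%:E <= (4 / F t)%:E * lorentz_norm F x)%E.
Proof.
move=> qF t0 t1 Ft mx.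
have := @integral_lorentz_le F x (cst 1%E) (F t)^-1 qF mx.
under eq_integral do rewrite mule1.
apply=> //.
  by rewrite invr_ge0 ltW.
move=> E mE ED; have [E1 Efin] := lebesgue_measure_sub01 mE ED.
rewrite integral_cst// mul1e lee_pdivlMl//.
rewrite -[X in (_ * X)%E](fineK Efin) -EFinM mulrC stieltjes_measure_ge_linear//.
by rewrite fine_ge0//= -lee_fin fineK.
Qed.

Lemma lorentz_sub_L1 F t : quasiconcave F -> 0 < t -> t < 1 -> 0 < F t ->
  lorentz F `<=` L1.
Proof.
move=> qF t0 t1 Ft x [mx xfin]; apply/integrableP; split.
  exact/measurable_EFinP.
apply: (le_lt_trans (lorentz_L1_le qF t0 t1 Ft mx)).
by rewrite lte_mul_pinfty// lee_fin divr_ge0// ltW.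
Qed.

End Dominance.

(** * Two integrals of powers *)
Section FTC.
Context {R : realType}.
Local Notation leb := (@lebesgue_measure R).
Implicit Types (a b s t : R).

(** The fundamental theorem of calculus on the positive half-line. *)
Lemma integral_pos_primitive (f F : R -> R) a b :
  (forall x : R, 0 < x -> is_derive x 1 F (f x)) ->
  (forall x : R, 0 < x -> {for x, continuous f}) ->
  0 < a -> a < b ->
  (\int[leb]_(x in `]a, b[) (f x)%:E = (F b - F a)%:E)%E.
Proof.
move=> dF cf a0 ab.
have ab0 (x : R) : x \in `[a, b] -> 0 < x.
  by rewrite in_itv/= => /andP[ax _]; exact: lt_le_trans ax.
have cF x : 0 < x -> {for x, continuous F}.
  move=> x0; apply: differentiable_continuous; apply/derivable1_diffP.
  by have := dF x x0 => -[].
have cfw : {within `[a, b], continuous f}.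
  by apply: continuous_in_subspaceT => x; rewrite inE/= => xab; apply: cf; exact: ab0.
rewrite -(@integral_itv_bndoo _ a b _ true false); last first.
  apply/measurable_EFinP; apply: (@measurable_funS _ _ _ _ `[a, b]%classic) => //.
    exact: subset_itv_oo_cc.
  by apply: subspace_continuous_measurable_fun => //; exact: measurable_itv.
rewrite (@continuous_FTC2 _ f F a b)//.
  split.
  - move=> x /subset_itv_oo_cc xab; have := dF x (ab0 _ xab) => -[//].
  - by apply: cvg_at_right_filter; apply: cF.
  - by apply: cvg_at_left_filter; apply: cF; exact: lt_trans ab.
move=> x /subset_itv_oo_cc xab; rewrite derive1E.
by have := dF x (ab0 _ xab) => -[].
Qed.

Lemma integral_invr_sqr a b : 0 < a -> a < b ->
  (\int[leb]_(x in `]a, b[) ((x ^+ 2)^-1)%:E = (a^-1 - b^-1)%:E)%E.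
Proof.
move=> a0 ab; rewrite (_ : a^-1 - b^-1 = - b^-1 - - a^-1); last by ring.
apply: (@integral_pos_primitive _ (fun x => - x^-1)) => //.
- move=> x x0; have x0' : x != 0 by rewrite gt_eqF.
  have dV := @is_deriveV R id x 1 1 x0' (is_derive_id _ _).
  have -> : (x ^+ 2)^-1 = - (- x ^- 2 *: 1) by rewrite [_ *: _]mulr1 opprK.
  exact: (@is_deriveN _ _ _ _ _ _ _ dV).
- move=> x x0; apply: cvgV; first by rewrite gt_eqF// exprn_gt0.
  by apply: exprn_continuous.
Qed.

Lemma integral_invr a b : 0 < a -> a < b ->
  (\int[leb]_(x in `]a, b[) (x^-1)%:E = (ln b - ln a)%:E)%E.
Proof.
move=> a0 ab; apply: (@integral_pos_primitive _ (@ln R)) => //.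
by move=> x x0; apply: cvgV; [rewrite gt_eqF|exact: cvg_id].
Qed.

End FTC.

(** * A nonincreasing majorant of the Calderon operator *)
Section CalderonEstimates.
Context {R : realType}.
Implicit Types (x F : R -> R) (s t u l r : R).
Local Notation RR := (measurableTypeR R).
Local Notation I01 := (`]0, 1[%classic : set R).
Local Notation leb := (@lebesgue_measure R).

Let mI (a b : R) : measurable (`]a, b[%classic : set R).
Proof. exact: measurable_itv. Qed.

Let subl t : t <= 1 -> `]0, t[%classic `<=` I01.
Proof.
by move=> t1 s /=; rewrite !in_itv/= => /andP[-> /lt_le_trans]; exact.
Qed.

Let subr t : 0 <= t -> `]t, 1[%classic `<=` I01.
Proof.
by move=> t0 s /=; rewrite !in_itv/= => /andP[/(le_lt_trans t0)-> ->].
Qed.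

(** The integrals of the positive and negative parts of f are monotone in t.
    No integrability of f is needed. *)
Lemma measurable_integral_left (f : R -> \bar R) : measurable_fun I01 f ->
  measurable_fun I01 (fun t => \int[leb]_(s in `]0%R, t[) f s)%E.
Proof.
move=> mf; rewrite (_ : (fun t => _) = (fun t =>
    \int[leb]_(s in `]0%R, t[) f^\+ s - \int[leb]_(s in `]0%R, t[) f^\- s)%E); last first.
  by apply/funext => t; rewrite [LHS]integralE.
have mono (g : R -> \bar R) : measurable_fun I01 g -> (forall s, 0 <= g s)%E ->
    measurable_fun I01 (fun t => \int[leb]_(s in `]0%R, t[) g s)%E.
  move=> mg g0; apply: nondecreasing_emeasurable; first exact: interval_is_interval.
  move=> s t /=; rewrite !in_itv/= => /andP[s0 s1] /andP[t0 t1] st.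
  apply: ge0_subset_integral => //.
    by apply: measurable_funS mg => //; apply: subl; exact: ltW.
  by move=> u /=; rewrite !in_itv/= => /andP[-> /lt_le_trans]; exact.
by apply: emeasurable_funB; apply: mono => //;
  [exact: measurable_funepos|exact: measurable_funeneg].
Qed.

Lemma measurable_integral_right (f : R -> \bar R) : measurable_fun I01 f ->
  measurable_fun I01 (fun t => \int[leb]_(s in `]t, 1%R[) f s)%E.
Proof.
move=> mf; rewrite (_ : (fun t => _) = (fun t =>
    \int[leb]_(s in `]t, 1%R[) f^\+ s - \int[leb]_(s in `]t, 1%R[) f^\- s)%E); last first.
  by apply/funext => t; rewrite [LHS]integralE.
have mono (g : R -> \bar R) : measurable_fun I01 g -> (forall s, 0 <= g s)%E ->
    measurable_fun I01 (fun t => \int[leb]_(s in `]t, 1%R[) g s)%E.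
  move=> mg g0; apply: nonincreasing_emeasurable; first exact: interval_is_interval.
  move=> s t /=; rewrite !in_itv/= => /andP[s0 s1] /andP[t0 t1] st.
  apply: ge0_subset_integral => //.
    by apply: measurable_funS mg => //; apply: subr; exact: ltW.
  by move=> u /=; rewrite !in_itv/= => /andP[/(le_lt_trans st)-> ->].
by apply: emeasurable_funB; apply: mono => //;
  [exact: measurable_funepos|exact: measurable_funeneg].
Qed.

Lemma measurable_invr01 : measurable_fun I01 (fun s : R => s^-1).
Proof.
apply/measurable_EFinP; apply: nonincreasing_emeasurable.
  exact: interval_is_interval.
move=> s t /=; rewrite !in_itv/= => /andP[s0 s1] /andP[t0 t1] st.
by rewrite lee_fin lef_pV2.
Qed.

Lemma measurable_invr_sqr01 : measurable_fun I01 (fun r : R => (r ^+ 2)^-1).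
Proof.
apply/measurable_EFinP; apply: nonincreasing_emeasurable.
  exact: interval_is_interval.
move=> s r /=; rewrite !in_itv/= => /andP[s0 s1] /andP[r0 r1] sr.
by rewrite lee_fin lef_pV2 ?posrE ?exprn_gt0// lerXn2r// nnegrE ltW.
Qed.

Lemma measurable_calderon x : measurable_fun I01 x ->
  measurable_fun I01 (calderon x).
Proof.
move=> mx; have mf (g : R -> \bar R) : measurable_fun I01 g ->
    measurable_fun I01 (fun t => fine (g t)).
  by move=> mg; apply: measurableT_comp => //; exact: fine_measurable.
apply: measurable_funD.
  apply: measurable_funM; first exact: measurable_invr01.
  by apply: mf; apply: measurable_integral_left; exact/measurable_EFinP.
apply: mf; apply: measurable_integral_right; apply/measurable_EFinP.
by apply: measurable_funM => //; exact: measurable_invr01.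
Qed.

(** No integrability is needed: a non-integrable f has real integral 0. *)
Lemma normr_Rintegral_le (D : set R) (f : R -> R) : measurable D ->
  measurable_fun D f ->
  ((`|\int[leb]_(s in D) f s|)%:E <= \int[leb]_(s in D) (`|f s|)%:E)%E.
Proof.
move=> mD mf.
have mEf : measurable_fun D (fun s => (f s)%:E) by exact/measurable_EFinP.
apply: le_trans (@le_abse_integral _ _ _ leb D _ mD mEf).
rewrite /Rintegral; case: (\int[leb]_(s in D) (f s)%:E)%E => //=;
  by rewrite normr0 leey.
Qed.

(** |S x(t)| is at most the integral of |x(s)| / max(s,t), and
    1 / max(s,t) = 1 + int_(max(s,t))^1 r^-2 dr. *)
Lemma calderon_majorant x t : measurable_fun I01 x -> 0 < t < 1 ->
  ((`|calderon x t|)%:E <= \int[leb]_(s in I01) (`|x s|)%:E +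
    \int[leb]_(r in `]t, 1%R[)
      (((r ^+ 2)^-1)%:E * \int[leb]_(s in `]0%R, r[) (`|x s|)%:E))%E.
Proof.
move=> mx /andP[t0 t1].
have mxn : measurable_fun I01 (fun s => (`|x s|)%:E).
  by apply/measurable_EFinP; apply: measurableT_comp => //; exact: measurable_normr.
have m2 : measurable_fun I01 (fun r => ((r ^+ 2)^-1)%:E).
  by apply/measurable_EFinP; exact: measurable_invr_sqr01.
pose k r := (((r ^+ 2)^-1)%:E * (\1_(`]t, 1%R[%classic : set R) r)%:E)%E.
have mk : measurable_fun I01 k.
  apply: emeasurable_funM => //; apply/measurable_EFinP.
  by apply: measurable_indic; exact: mI.
have k0 r : (0 <= k r)%E.
  by rewrite mule_ge0 ?lee_fin// invr_ge0 exprn_even_ge0.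
have kE s : 0 < s -> s < 1 ->
    (\int[leb]_(r in `]s, 1%R[) k r = ((Num.max s t)^-1 - 1)%:E)%E.
  move=> s0 s1.
  have m0 : 0 < Num.max s t by rewrite lt_max s0.
  have m1 : Num.max s t < 1 by rewrite gt_max s1.
  rewrite -[X in (_ - X)%:E]invr1 -(integral_invr_sqr m0 m1).
  rewrite [LHS]integral_mkcond [RHS]integral_mkcond; apply: eq_integral => r _.
  rewrite !patchE /k indicE.
  have -> : (r \in `](Num.max s t), 1[%classic) =
      (r \in `]s, 1[%classic) && (r \in `]t, 1[%classic).
    apply/idP/andP; rewrite !inE/= !in_itv/= gt_max.
      by move=> /andP[/andP[-> ->] ->].
    by move=> [/andP[-> ->] /andP[->]].
  by case: (_ \in _) => //=; case: (_ \in _); rewrite ?mule1 ?mule0.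
have -> : (\int[leb]_(r in `]t, 1%R[)
      (((r ^+ 2)^-1)%:E * \int[leb]_(s in `]0%R, r[) (`|x s|)%:E) =
    \int[leb]_(r in I01) (k r * \int[leb]_(s in `]0%R, r[) (`|x s|)%:E))%E.
  rewrite [LHS]integral_mkcond [RHS]integral_mkcond; apply: eq_integral => r _.
  rewrite !patchE /k indicE.
  case: (boolP (r \in `]t, 1[%classic)) => rt /=; last first.
    by rewrite mule0 mul0e; case: ifP.
  rewrite mule1 ifT//; move: rt; rewrite !inE/=; apply: subr; exact: ltW.
have := @tonelli_triangle R leb (fun s => (`|x s|)%:E) k.
move=> <- //.
rewrite -ge0_integralD//; last 2 first.
- by move=> s _; rewrite mule_ge0// integral_ge0.
- by apply: emeasurable_funM => //; exact: measurable_integral_right.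
apply: (@le_trans _ _ (\int[leb]_(s in I01) ((`|x s|)%:E * ((Num.max s t)^-1)%:E))%E);
  last first.
  rewrite le_eqVlt; apply/orP; left; apply/eqP/eq_integral => s.
  rewrite inE/= in_itv/= => /andP[s0 s1].
  by rewrite kE// -EFinM -EFinD; congr (_%:E); ring.
have mM : measurable_fun I01 (fun s => (`|x s|)%:E * ((Num.max s t)^-1)%:E)%E.
  apply: emeasurable_funM => //; apply: nonincreasing_emeasurable.
    exact: interval_is_interval.
  move=> s r /=; rewrite !in_itv/= => /andP[s0 s1] /andP[r0 r1] sr.
  rewrite lee_fin lef_pV2 ?posrE ?lt_max ?s0 ?r0//.
  by rewrite ge_max le_max sr/= le_max lexx orbT.
have M0 s : I01 s -> (0 <= (`|x s|)%:E * ((Num.max s t)^-1)%:E)%E.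
  rewrite /= in_itv/= => /andP[s0 s1].
  by rewrite mule_ge0// lee_fin invr_ge0 le_max (ltW s0).
apply: (@le_trans _ _ (\int[leb]_(s in `]0%R, t[ `|` `]t, 1%R[)
    ((`|x s|)%:E * ((Num.max s t)^-1)%:E))%E); last first.
  apply: ge0_subset_integral => //; first exact: measurableU.
  by rewrite subUset; split; [apply: subl; exact: ltW|apply: subr; exact: ltW].
have sU : `]0, t[%classic `|` `]t, 1[%classic `<=` I01.
  by rewrite subUset; split; [apply: subl; exact: ltW|apply: subr; exact: ltW].
rewrite ge0_integral_setU//; last 3 first.
- exact: measurable_funS mM.
- by move=> s /sU; exact: M0.
- rewrite disj_set2E; apply/eqP/seteqP; split=> // s /=.
  by rewrite !in_itv/= => -[/andP[_ a] /andP[b _]]; have := lt_trans a b; rewrite ltxx.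
rewrite /calderon.
apply: (@le_trans _ _ ((`|t^-1 * \int[leb]_(s in `]0, t[) x s|)%:E +
    (`|\int[leb]_(s in `]t, 1[) (x s / s)|)%:E)%E).
  by rewrite -EFinD lee_fin ler_normD.
have sl : `]0, t[%classic `<=` I01 by apply: subl; exact: ltW.
have sr : `]t, 1[%classic `<=` I01 by apply: subr; exact: ltW.
apply: leeD.
  have ti : 0 <= t^-1 by rewrite invr_ge0 ltW.
  rewrite normrM (ger0_norm ti) EFinM.
  apply: (@le_trans _ _ (t^-1%:E * \int[leb]_(s in `]0%R, t[) (`|x s|)%:E)%E).
    apply: lee_wpmul2l; first by rewrite lee_fin.
    by apply: normr_Rintegral_le => //; exact: measurable_funS mx.
  rewrite -ge0_integralZl//; last exact: measurable_funS mxn.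
  rewrite le_eqVlt; apply/orP; left; apply/eqP/eq_integral => s.
  rewrite inE/= in_itv/= => /andP[s0 st].
  by rewrite muleC (max_idPr _)// ltW.
apply: le_trans (normr_Rintegral_le _ _) _ => //.
  apply: measurable_funM; first exact: measurable_funS mx.
  by apply: measurable_funS measurable_invr01.
rewrite le_eqVlt; apply/orP; left; apply/eqP/eq_integral => s.
rewrite inE/= in_itv/= => /andP[ts s1].
rewrite normrM -EFinM (max_idPl (ltW ts)) [`|s^-1|]ger0_norm// invr_ge0 ltW//.
exact: lt_trans ts.
Qed.

End CalderonEstimates.

(** * Boundedness of the Calderon operator *)
(** The hypotheses keep only what boundedness uses of phi and psi: that they
    are quasi-concave, that phi is positive and the integral inequality. *)
Section Bounded.
Context {R : realType}.
Local Notation RR := (measurableTypeR R).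
Local Notation I01 := (`]0, 1[%classic : set R).
Local Notation leb := (@lebesgue_measure R).
Local Notation dS F := (lebesgue_stieltjes_measure (stieltjes_ext F)).
Implicit Types (x : R -> R) (s t u r : R).

Let mI (a b : R) : measurable (`]a, b[%classic : set R).
Proof. exact: measurable_itv. Qed.

Variables (phi psi : R -> R) (c : R).
Hypothesis qphi : quasiconcave phi.
Hypothesis qpsi : quasiconcave psi.
Hypothesis phi_gt0 : forall t, 0 < t -> t < 1 -> 0 < phi t.
Hypothesis phi_psi : forall u : R, u \in `]0, 1[ ->
    (\int[leb]_(t in `]0%R, u[) (psi t / t)%:E
     + u%:E * \int[leb]_(t in `]u, 1%R[) (psi t / t ^+ 2)%:E
     <= (c * phi u)%:E)%E.

Let psi0 t : I01 t -> 0 <= psi t.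
Proof.
have [p0 _ _ _] := qpsi; rewrite /= in_itv/= => /andP[t0 t1].
by apply: p0; rewrite in_itv/= (ltW t0).
Qed.

Let mpsi : measurable_fun I01 (fun r => (psi r / r ^+ 2)%:E).
Proof.
have [_ pnd _ _] := qpsi.
apply/measurable_EFinP; apply: measurable_funM.
  apply/measurable_EFinP; apply: nondecreasing_emeasurable.
    exact: interval_is_interval.
  move=> s t /=; rewrite !in_itv/= => /andP[s0 s1] /andP[t0 t1] st.
  by rewrite lee_fin pnd// in_itv/= ltW.
exact: measurable_invr_sqr01.
Qed.

Let psi_ge0 r : I01 r -> (0 <= (psi r / r ^+ 2)%:E)%E.
Proof.
by move=> r01; rewrite lee_fin divr_ge0 ?psi0// exprn_even_ge0.
Qed.

Let half01 : (2^-1 : R) \in `]0, 1[.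
Proof. by rewrite in_itv/=; apply/andP; split; lra. Qed.

Lemma constant_ge0 : 0 <= c.
Proof.
have p0 : 0 < phi 2^-1 by apply: phi_gt0; lra.
rewrite -(pmulr_lge0 _ p0) -lee_fin; apply: le_trans (phi_psi half01).
have H (s : R) : s \in `]0, 1[ -> I01 s by [].
apply: adde_ge0.
  apply: integral_ge0 => t /=; rewrite in_itv/= => /andP[t0 t1].
  by rewrite lee_fin divr_ge0 ?(ltW t0)// psi0//= in_itv/= t0; lra.
apply: mule_ge0; first by rewrite lee_fin; lra.
apply: integral_ge0 => t /=; rewrite in_itv/= => /andP[t0 t1].
by apply: psi_ge0; rewrite /= in_itv/= t1 andbT; lra.
Qed.

(** By Tonelli's theorem the left-hand side is the integral over r of
    psi(r) / r^2 times the measure of E in ]0,r[, which is at most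
    min(r, |E|). *)
Lemma kernel_integral_le (E : set R) : measurable E -> E `<=` I01 ->
  (\int[leb]_(s in E) (\int[leb]_(r in `]s, 1%R[) (psi r / r ^+ 2)%:E) <=
   (2 * c)%:E * dS phi `]0%R, (fine (leb E))[%classic)%E.
Proof.
move=> mE ED; have [E1 Efin] := lebesgue_measure_sub01 mE ED.
set a := fine (leb E).
have a0 : 0 <= a by rewrite fine_ge0.
have a1 : a <= 1 by rewrite -lee_fin /a fineK.
have c0 := constant_ge0.
have mE1 : measurable_fun I01 (fun s => (\1_E s)%:E : \bar R).
  by apply/measurable_EFinP; exact: measurable_indic.
rewrite -(setIidr ED) integral_mkcondr.
rewrite (_ : (\int[leb]_(s in I01) _)%E = (\int[leb]_(s in I01)
    ((\1_E s)%:E * \int[leb]_(r in `]s, 1%R[) (psi r / r ^+ 2)%:E))%E); last first.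
  apply: eq_integral => s _; rewrite patchE indicE.
  by case: (s \in E); rewrite ?mul1e ?mul0e.
rewrite tonelli_triangle//.
have M r : 0 < r -> r < 1 ->
    (\int[leb]_(s in `]0%R, r[) (\1_E s)%:E <= (Num.min r a)%:E)%E.
  move=> r0 r1; rewrite integral_indic// EFin_min le_min; apply/andP; split.
    apply: (@le_trans _ _ (leb `]0, r[%classic)).
      by apply: le_measure; rewrite ?inE//; exact: measurableI.
    by rewrite lebesgue_measure_itv/= lte_fin r0 sube0.
  rewrite /a fineK//; by apply: le_measure; rewrite ?inE//; exact: measurableI.
have M0 r : (0 <= \int[leb]_(s in `]0%R, r[) (\1_E s)%:E :> \bar R)%E.
  by apply: integral_ge0 => s _; rewrite lee_fin.
have mM : measurable_fun I01
   (fun r => (psi r / r ^+ 2)%:E * \int[leb]_(s in `]0%R, r[) (\1_E s)%:E)%E.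
  by apply: emeasurable_funM => //; exact: measurable_integral_left.
have [az|az] := eqVneq a 0.
  rewrite le_eqVlt; apply/orP; left; apply/eqP.
  rewrite az set_itvoo0 measure0 mule0; apply: integral0_eq => r /=.
  rewrite in_itv/= => /andP[r0 r1]; rewrite (_ : (\int[leb]_(s in _) _ = 0)%E) ?mule0//.
  apply/eqP; rewrite eq_le M0 andbT; apply: (le_trans (M _ r0 r1)).
  by rewrite az lee_fin ge_min lexx orbT.
have {az}a_gt0 : 0 < a by rewrite lt_neqAle eq_sym az.
(* When a = 1 the integral inequality is not available at a itself, and 1 / 2
   replaces it, at the price of the factor 2. *)
have [b [b0 b1 ab ba]] : exists b, [/\ 0 < b, b < 1, a <= 2 * b & b <= a].
  have [a1'|a1'] := ltP a 1.
    by exists a; split=> //; lra.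
  by exists 2^-1; split=> //; lra.
have bI : b \in `]0, 1[ by rewrite in_itv/= b0.
apply: (@le_trans _ _ ((2 * (c * phi b))%:E)); last first.
  rewrite mulrA EFinM; apply: lee_wpmul2l; first by rewrite lee_fin mulr_ge0.
  apply: (le_trans (stieltjes_measure_oo_ge qphi b0 b1)).
  exact: le_stieltjes_measure_oo.
rewrite EFinM; apply: (@le_trans _ _ (2%:E * (\int[leb]_(t in `]0%R, b[) (psi t / t)%:E
     + b%:E * \int[leb]_(t in `]b, 1%R[) (psi t / t ^+ 2)%:E))%E); last first.
  by apply: lee_wpmul2l => //; exact: phi_psi.
have sl : `]0, b[%classic `<=` I01.
  by move=> s /=; rewrite !in_itv/= => /andP[-> /lt_trans]; exact.
have sr : `[b, 1[%classic `<=` I01.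
  by move=> s /=; rewrite !in_itv/= => /andP[/(lt_le_trans b0) -> ->].
have sr' : `]b, 1[%classic `<=` I01.
  by move=> s /=; rewrite !in_itv/= => /andP[/(lt_trans b0) -> ->].
have D0 r : I01 r -> (0 <= (psi r / r ^+ 2)%:E * \int[leb]_(s in `]0%R, r[) (\1_E s)%:E)%E.
  by move=> Dr; rewrite mule_ge0// psi_ge0.
have -> : I01 = `]0, b[%classic `|` `[b, 1[%classic.
  apply/seteqP; split=> s /=; rewrite !in_itv/=.
    by move=> /andP[-> ->]; rewrite andbT/=; case: (ltP s b); [left|right].
  by move=> [/andP[-> /lt_trans]|/andP[/(lt_le_trans b0) -> ->]//]; apply.
rewrite ge0_integral_setU//; last 3 first.
- by move: mM; apply: measurable_funS => //; rewrite subUset.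
- by move=> r [/sl|/sr]; exact: D0.
- rewrite disj_set2E; apply/eqP/seteqP; split=> // s /=.
  by rewrite !in_itv/= => -[/andP[_ h] /andP[h' _]]; have := lt_le_trans h h'; rewrite ltxx.
rewrite muleDr; last 2 first.
- by [].
- apply: ge0_adde_def; rewrite inE.
    apply: integral_ge0 => t Dt; rewrite lee_fin divr_ge0//; first exact/psi0/sl.
    by move: Dt; rewrite /= in_itv/= => /andP[/ltW].
  rewrite mule_ge0 ?lee_fin ?(ltW b0)//; apply: integral_ge0 => t Dt.
  exact/psi_ge0/sr'.
have mq : measurable_fun `]0, b[%classic (fun t => (psi t / t)%:E).
  have : measurable_fun I01 (fun t => (psi t / t)%:E).
    apply/measurable_EFinP; apply: measurable_funM; last exact: measurable_invr01.
    apply/measurable_EFinP; apply: nondecreasing_emeasurable.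
      exact: interval_is_interval.
    have [_ pnd _ _] := qpsi.
    move=> s t /=; rewrite !in_itv/= => /andP[s0 s1] /andP[t0 t1] st.
    by rewrite lee_fin pnd// in_itv/= ltW.
  exact: measurable_funS.
have q0 t : `]0, b[%classic t -> (0 <= (psi t / t)%:E)%E.
  move=> Dt; rewrite lee_fin divr_ge0//; first exact/psi0/sl.
  by move: Dt; rewrite /= in_itv/= => /andP[/ltW].
apply: leeD.
  apply: (@le_trans _ _ (\int[leb]_(t in `]0%R, b[) (psi t / t)%:E)%E); last first.
    have I0 := @integral_ge0 _ _ _ leb _ _ q0.
    by rewrite -[leLHS]mul1e lee_wpmul2r// lee_fin ler1n.
  apply: ge0_le_integral => //.
  - by move=> r /sl; exact: D0.
  - exact: measurable_funS mM.
  move=> r /[dup] Dr; rewrite /= in_itv/= => /andP[r0 rb].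
  apply: (@le_trans _ _ ((psi r / r ^+ 2)%:E * r%:E)%E).
    apply: lee_wpmul2l; first exact/psi_ge0/sl.
    by apply: (le_trans (M _ r0 (lt_trans rb b1))); rewrite lee_fin ge_min lexx.
  by rewrite -EFinM lee_fin le_eqVlt; apply/orP; left; apply/eqP; field; rewrite gt_eqF.
rewrite muleA -EFinM -ge0_integralZl//; last 3 first.
- exact: measurable_funS mpsi.
- by move=> t /sr'; exact: psi_ge0.
- by rewrite lee_fin mulr_ge0// ltW.
rewrite -integral_itv_obnd_cbnd//; last exact: measurable_funS mM.
apply: ge0_le_integral => //.
- by move=> r /sr'; exact: D0.
- exact: measurable_funS mM.
- by apply: measurable_funeM; exact: measurable_funS mpsi.
move=> r /[dup] Dr; rewrite /= in_itv/= => /andP[br r1].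
rewrite muleC; apply: lee_wpmul2r; first exact/psi_ge0/sr'.
apply: (le_trans (M _ (lt_trans b0 br) r1)).
by rewrite lee_fin ge_min ab orbT.
Qed.

(** Integrating against dpsi the majorant of S x; the term with int |x|
    yields the first summand of the constant, and [kernel_integral_le] the
    second one. *)
Lemma calderon_lorentz_le x : lorentz phi x ->
  (lorentz_norm psi (calderon x) <=
   (4 / phi 2^-1 * fine (dS psi `]0%R, 1%R[%classic) + 4 * (2 * c))%:E *
   lorentz_norm phi x)%E.
Proof.
move=> [mx xfin]; have c0 := constant_ge0.
have h0 : 0 < (2^-1 : R) by lra.
have h1 : (2^-1 : R) < 1 by lra.
have p0 := phi_gt0 h0 h1.
have mxn : measurable_fun I01 (fun s => (`|x s|)%:E).
  by apply/measurable_EFinP; apply: measurableT_comp => //; exact: measurable_normr.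
(* A, X and g are introduced by equations in order to keep the integrals that
   they abbreviate opaque. *)
have [A AE] : {A | A = (\int[leb]_(s in I01) (`|x s|)%:E)%E} by eexists.
have A0 : (0 <= A)%E by rewrite AE; exact: integral_ge0.
have HA := lorentz_L1_le qphi h0 h1 p0 mx; rewrite -AE in HA.
have N0 := lorentz_norm_ge0 phi x.
have [X XE] : {X : R -> \bar R |
    X = fun r => (\int[leb]_(s in `]0%R, r[) (`|x s|)%:E)%E} by eexists.
have X0 r : (0 <= X r)%E by rewrite XE; exact: integral_ge0.
have mX : measurable_fun I01 X by rewrite XE; exact: measurable_integral_left.
have [g gE] : {g : R -> \bar R | g = fun r => (((r ^+ 2)^-1)%:E * X r)%E} by eexists.
have g0 r : (0 <= g r)%E.
  by rewrite gE; apply: mule_ge0; rewrite ?X0// lee_fin invr_ge0 exprn_even_ge0.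
have mg : measurable_fun I01 g.
  rewrite gE; apply: emeasurable_funM; last exact: mX.
  by apply/measurable_EFinP; exact: measurable_invr_sqr01.
pose G t := (A + \int[leb]_(r in `]t, 1%R[) g r)%E.
have mIg : measurable_fun I01 (fun t => \int[leb]_(r in `]t, 1%R[) g r)%E.
  exact: measurable_integral_right.
have Gni u v : 0 < u -> u <= v -> v < 1 -> (G v <= G u)%E.
  move=> u0 uv v1; apply: leeD; first exact: lexx.
  apply: ge0_subset_integral; [exact: mI|exact: mI| |by move=> s _; exact: g0|].
    apply: measurable_funS mg; first exact: mI.
    move=> s /=; rewrite !in_itv/=.
    by move=> /andP[/(lt_trans u0)-> ->].
  by move=> s /=; rewrite !in_itv/= => /andP[/(le_lt_trans uv)-> ->].
apply: (@le_trans _ _ (\int[dS psi]_(t in I01) G t)%E).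
  apply: ge0_le_integral => //.
  - by move=> s _; rewrite lee_fin rearrangement_ge0.
  - apply/measurable_EFinP; apply: measurable_rearrangement.
    exact: measurable_calderon.
  - by apply: emeasurable_funD.
  move=> t /=; rewrite in_itv/= => t01.
  apply: rearrangement_le_nonincreasing => //; first exact: measurable_calderon.
  by move=> u u01; rewrite /G AE gE XE; exact: calderon_majorant.
have Ig0 t : I01 t -> (0 <= \int[leb]_(r in `]t, 1%R[) g r)%E.
  by move=> _; apply: integral_ge0 => r _; exact: g0.
rewrite (ge0_integralD (dS psi) (mI 0 1) (fun t _ => A0) (measurable_cst _) Ig0 mIg).
rewrite (integral_cst (dS psi) (mI 0 1)).
have Kfin : dS psi `]0%R, 1%R[%classic \is a fin_num.
  by apply: stieltjes_measure_fin; rewrite ?lexx.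
rewrite EFinD ge0_muleDl; last 2 first.
- by rewrite lee_fin mulr_ge0 ?fine_ge0// divr_ge0// ltW.
- by rewrite lee_fin !mulr_ge0.
apply: leeD.
  rewrite mulrC EFinM -muleA fineK// muleC.
  by apply: lee_wpmul2l.
rewrite (_ : (\int[dS psi]_(t in I01) _ = \int[dS psi]_(t in I01)
    ((cst 1%E t) * \int[leb]_(r in `]t, 1%R[) g r))%E); last first.
  by apply: eq_integral => t _; rewrite mul1e.
rewrite (tonelli_triangle _ (fun t _ => lee01) (fun t _ => g0 t) (measurable_cst _) mg).
have := @integral_lorentz_le R phi x
  (fun s => \int[leb]_(r in `]s, 1%R[) (psi r / r ^+ 2)%:E)%E (2 * c).
move=> /(_ qphi mx) H; apply: le_trans (H _ _ _ _); last 4 first.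
- by rewrite mulr_ge0.
- move=> s /=; rewrite in_itv/= => /andP[s0 s1]; apply: integral_ge0 => r /=.
  rewrite in_itv/= => /andP[sr r1]; apply: psi_ge0.
  by rewrite /= in_itv/= r1 (lt_trans s0).
- exact: measurable_integral_right.
- exact: kernel_integral_le.
have nx0 t : I01 t -> (0 <= (`|x t|)%:E)%E by move=> _; rewrite lee_fin.
rewrite [leRHS](tonelli_triangle leb nx0 psi_ge0 mxn mpsi).
apply: ge0_le_integral; first exact: mI.
- by move=> r _; apply: mule_ge0; [exact: g0|exact: integral_ge0].
- apply: emeasurable_funM; first exact: mg.
  apply: nondecreasing_emeasurable; first exact: interval_is_interval.
  move=> s t /=; rewrite !in_itv/= => /andP[s0 s1] /andP[t0 t1] st.
  by rewrite !integral_cst// !mul1e; exact: le_stieltjes_measure_oo.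
- by apply: emeasurable_funM; [exact: mpsi|rewrite -XE; exact: mX].
move=> r /[dup] Dr; rewrite /= in_itv/= => /andP[r0 r1].
rewrite (integral_cst (dS psi) (mI 0 r)) mul1e gE.
have -> : (\int[leb]_(s in `]0%R, r[) (`|x s|)%:E = X r)%E by rewrite XE.
rewrite muleAC; apply: lee_wpmul2r => //.
rewrite [(psi r / _)%R]mulrC EFinM; apply: lee_wpmul2l.
  by rewrite lee_fin invr_ge0 exprn_even_ge0.
by apply: stieltjes_measure_oo_le => //; exact: ltW.
Qed.

Lemma calderon_bounded_lorentz : calderon_bounded phi psi.
Proof.
have h0 : 0 < (2^-1 : R) by lra.
have h1 : (2^-1 : R) < 1 by lra.
have p0 := phi_gt0 h0 h1.
split; first exact: (lorentz_sub_L1 qphi h0 h1).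
exists (4 / phi 2^-1 * fine (dS psi `]0%R, 1%R[%classic) + 4 * (2 * c)) => x Lx.
have H := calderon_lorentz_le Lx; split; last exact: H.
split.
  by apply: measurable_calderon; case: Lx.
apply: (le_lt_trans H); apply: lte_mul_pinfty; [|by []|by case: Lx].
have c0 := constant_ge0.
by rewrite lee_fin addr_ge0// !mulr_ge0// ?invr_ge0 ?(ltW p0)// fine_ge0.
Qed.

End Bounded.

(** * Majorizing indicators, and lower bounds for the Calderon operator *)
Section Choice.
Context {R : realType}.
Variable phi : R -> R.
Implicit Types (s t u w v : R).
Local Notation dS F := (lebesgue_stieltjes_measure (stieltjes_ext F)).
Hypothesis phi01 : forall t : R, t \in `[0, 1[ -> 0 <= phi t < 1.
Hypothesis phi_incr : {in `[0, 1[ &, {homo phi : s t / s <= t}}.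
Hypothesis phi_neq0 : exists2 t : R, t \in `]0, 1[ & phi t != 0.
Hypothesis phi_concave : concave01 phi.
Hypothesis phi0 : phi t @[t --> 0^'+] --> (0 : R).

Let qphi := concave_quasiconcave phi01 phi_incr phi_concave phi0.
Let qpsi := psi_of_quasiconcave phi01 phi_incr phi_neq0 phi_concave phi0.

(** For p = (v, A), the function equal to A on ]0,v[ and to 0 elsewhere has
    S-image A (1 + ln (v / t)) at t < v, which is at least 1 for t < u, and
    its norm in the space of phi is at most 3/2 that of the indicator of ]0,u[
    in the space of psi. The points 0 and 1 are included for later use with
    arbitrary values of a distribution function. *)
Lemma psi_of_majorant u : 0 <= u <= 1 -> exists p : R * R,
  [/\ 0 <= p.2, 0 <= p.1 <= 1,
      (forall t, 0 < t < u -> t < p.1 /\ 1 <= p.2 * (1 + ln (p.1 / t))) &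
      (p.2%:E * dS phi `]0%R, p.1[%classic <=
       (3 / 2)%:E * dS (psi_of phi) `]0%R, u[%classic)%E].
Proof.
move=> /andP[]; rewrite le_eqVlt => /predU1P[<-|u0].
  move=> _; exists (0, 0); split=> //=.
  - by rewrite lexx ler01.
  - by move=> t /andP[t0 /(lt_trans t0)]; rewrite ltxx.
  - by rewrite mul0e mule_ge0// lee_fin divr_ge0.
rewrite le_eqVlt => /predU1P[->|u1].
  exists (1, 1); split; rewrite /= ?ler01 ?lexx//.
    move=> t /andP[t0 t1]; split=> //; rewrite mul1r lerDl ln_ge0// mul1r.
    by rewrite invf_ge1// ltW.
  rewrite mul1e.
  (* phi(s) <= phi(a) / a and a phi(a) <= psi(a) lose the factor a^-2, which
     is below 3/2 for a = 9 / 10. *)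
  have a0 : 0 < (9 / 10 : R) by lra.
  have a1 : (9 / 10 : R) < 1 by lra.
  have pa := concave01_gt0 phi01 phi_incr phi_neq0 phi_concave phi0 a0 a1.
  apply: (@le_trans _ _ ((3 / 2)%:E * (9 / 10 * phi (9 / 10))%:E)%E); last first.
    apply: lee_wpmul2l; first by rewrite lee_fin divr_ge0.
    apply: le_trans (stieltjes_measure_01_ge qpsi a0 a1).
    by rewrite lee_fin psi_of_ge_phi.
  rewrite -EFinM; apply: stieltjes_measure_01_le => // s /andP[s0 s1].
  have [_ _ fq _] := qphi.
  have [sa|as_] := leP s (9 / 10).
    have : phi s <= phi (9 / 10).
      by apply: phi_incr; rewrite ?in_itv/= ?s0 ?s1 ?a1 ?(ltW a0).
    by lra.
  have := fq _ _ a0 (ltW as_) s1.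
  have : s * phi (9 / 10) <= 1 * phi (9 / 10) by rewrite ler_wpM2r// ltW.
  by lra.
have pu0 := psi_of_gt0 phi01 phi_incr phi_neq0 phi_concave phi0 u0 u1.
have [w [w1 uw1 hw]] : exists w, [/\ 1 < w, u * w < 1 &
    phi (u * w) < 3 / 2 * psi_of phi u * (1 + ln w)].
  apply: contrapT => /forallNP H.
  suff : 3 / 2 * psi_of phi u <= psi_of phi u by lra.
  apply: psi_of_ge => // [|w w1 uw1]; first exact: ltW.
  by rewrite leNgt; apply/negP => h; exact: (H w).
have w0 : 0 < w by exact: lt_trans w1.
have l0 := ln_gt0 w1.
exists (u * w, (1 + ln w)^-1); split=> /=.
- by rewrite invr_ge0 addr_ge0// ltW.
- by rewrite mulr_ge0 ?ltW.
- move=> t /andP[t0 tu]; split.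
    by apply: (lt_trans tu); rewrite ltr_pMr.
  rewrite -[leLHS](@mulVf _ (1 + ln w)); last by rewrite gt_eqF// addr_gt0.
  rewrite ler_wpM2l ?invr_ge0 ?addr_ge0 ?(ltW l0)// lerD2l.
  rewrite ler_ln ?posrE ?divr_gt0 ?mulr_gt0// ler_pdivlMr// mulrC.
  by rewrite ler_wpM2r// ltW.
apply: (@le_trans _ _ ((3 / 2)%:E * (psi_of phi u)%:E)%E); last first.
  apply: lee_wpmul2l; first by rewrite lee_fin divr_ge0.
  exact: (stieltjes_measure_oo_ge qpsi u0 u1).
have uw0 : 0 <= u * w by rewrite mulr_ge0 ?ltW.
have := stieltjes_measure_oo_le qphi uw0 uw1.
have i0 : (0 <= ((1 + ln w)^-1)%:E)%E by rewrite lee_fin invr_ge0 addr_ge0// ltW.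
move=> /(lee_wpmul2l i0) /le_trans; apply.
by rewrite -!EFinM lee_fin ler_pdivrMl ?addr_gt0// [leRHS]mulrC ltW.
Qed.

End Choice.

Section LowerBounds.
Context {R : realType}.
Implicit Types (x y z F : R -> R) (s t u v a : R).
Local Notation RR := (measurableTypeR R).
Local Notation I01 := (`]0, 1[%classic : set R).
Local Notation leb := (@lebesgue_measure R).
Local Notation dS F := (lebesgue_stieltjes_measure (stieltjes_ext F)).

Let mI (a b : R) : measurable (`]a, b[%classic : set R).
Proof. exact: measurable_itv. Qed.

Lemma rearrangement_ge_cst y v a t : measurable_fun I01 y -> v <= 1 ->
  (forall s, 0 < s < v -> a <= y s) -> 0 < t < v -> a <= rearrangement y t.
Proof.
move=> my v1 ya /andP[t0 tv]; rewrite leNgt; apply/negP => ra.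
pose s := (rearrangement y t + a) / 2.
have s1 : rearrangement y t < s by rewrite /s; lra.
have s2 : s < a by rewrite /s; lra.
suff : s <= rearrangement y t by rewrite leNgt s1.
apply: rearrangement_ge => //; apply: (@lt_le_trans _ _ v%:E).
  by rewrite lte_fin.
have -> : v%:E = leb `]0, v[%classic.
  by rewrite lebesgue_measure_itv/= lte_fin (lt_trans t0 tv) sube0.
apply: le_measure; rewrite ?inE; [exact: mI|exact: measurable_superlevel|].
move=> u /=; rewrite in_itv/= => uv; split.
  by have /andP[-> /lt_le_trans] := uv; apply.
by rewrite (lt_le_trans s2)// (le_trans (ya _ uv))// ler_norm.
Qed.

Lemma lorentz_norm_ge F x t : quasiconcave F -> measurable_fun I01 x ->
  0 < t -> t < 1 -> ((rearrangement x t * F t)%:E <= lorentz_norm F x)%E.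
Proof.
move=> qF mx t0 t1.
apply: (@le_trans _ _ (\int[dS F]_(s in `]0%R, t[) (rearrangement x t)%:E)%E).
  rewrite integral_cst// EFinM lee_wpmul2l ?lee_fin ?rearrangement_ge0//.
  exact: stieltjes_measure_oo_ge.
have sD : `]0, t[%classic `<=` I01.
  by move=> s /=; rewrite !in_itv/= => /andP[-> /lt_trans]; exact.
have mr : measurable_fun I01 (fun s => (rearrangement x s)%:E).
  by apply/measurable_EFinP; exact: measurable_rearrangement.
have r0 s : (0 <= (rearrangement x s)%:E)%E by rewrite lee_fin rearrangement_ge0.
apply: (@le_trans _ _ (\int[dS F]_(s in `]0%R, t[) (rearrangement x s)%:E)%E).
  apply: ge0_le_integral; [exact: mI|by []|exact: measurable_cst| |].
    exact: measurable_funS mr.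
  move=> s /=; rewrite in_itv/= => /andP[s0 st].
  by rewrite lee_fin rearrangement_nonincreasing// ltW.
by apply: ge0_subset_integral; [exact: mI|exact: mI|exact: mr|by []|exact: sD].
Qed.

Lemma lorentz_rearrangement F x : lorentz F x -> lorentz F (rearrangement x).
Proof.
move=> [mx xfin]; have mr := measurable_rearrangement mx.
split; first exact: mr.
apply: le_lt_trans xfin; apply: ge0_le_integral; first exact: mI.
- by move=> s _; rewrite lee_fin rearrangement_ge0.
- by apply/measurable_EFinP; exact: measurable_rearrangement.
- exact/measurable_EFinP.
move=> t /=; rewrite in_itv/= => t01.
apply: (@rearrangement_le_nonincreasing _ _ (fun t => (rearrangement x t)%:E)) => //.
  by move=> u _; rewrite lee_fin ger0_norm// rearrangement_ge0.
by move=> u v u0 uv _; rewrite lee_fin rearrangement_nonincreasing.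
Qed.

Lemma calderon_ge0 z t : 0 < t -> (forall s, 0 <= z s) -> 0 <= calderon z t.
Proof.
move=> t0 z0; apply: addr_ge0.
  by rewrite mulr_ge0 ?invr_ge0 ?(ltW t0)// Rintegral_ge0.
apply: fine_ge0; apply: integral_ge0 => s /=; rewrite in_itv/= => /andP[ts _].
by rewrite lee_fin divr_ge0// ltW// (lt_trans t0).
Qed.

(** The right-hand factor 1 + ln (v / t) is the S-image at t of the indicator
    of ]0,v[. *)
Lemma calderon_ge z v a t : L1 z -> (forall s, 0 <= z s) -> 0 <= a -> v <= 1 ->
  (forall s, 0 < s < v -> a <= z s) -> 0 < t < v ->
  a * (1 + ln (v / t)) <= calderon z t.
Proof.
move=> /integrableP[mEz zfin] z0 a0 v1 az /andP[t0 tv].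
have mz : measurable_fun I01 z by exact/measurable_EFinP.
have t1 : t < 1 by exact: lt_le_trans v1.
have v0 : 0 < v by exact: lt_trans tv.
have zE : (\int[leb]_(s in I01) (z s)%:E < +oo)%E.
  apply: le_lt_trans zfin; apply: ge0_le_integral.
  - exact: mI.
  - by move=> s _; rewrite lee_fin.
  - exact: mEz.
  - exact: measurableT_comp.
  - by move=> s _; rewrite /= ger0_norm.
have sl : `]0, t[%classic `<=` I01.
  by move=> s /=; rewrite !in_itv/= => /andP[-> /lt_trans]; exact.
have sr : `]t, 1[%classic `<=` I01.
  by move=> s /=; rewrite !in_itv/= => /andP[/(lt_trans t0)-> ->].
have sm : `]t, v[%classic `<=` `]t, 1[%classic.
  by move=> s /=; rewrite !in_itv/= => /andP[-> /lt_le_trans]; exact.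
have zE0 s : (0 <= (z s)%:E)%E by rewrite lee_fin.
have mzs : measurable_fun `]t, 1[%classic (fun s => (z s / s)%:E).
  have : measurable_fun I01 (fun s => (z s / s)%:E).
    by apply/measurable_EFinP; apply: measurable_funM => //; exact: measurable_invr01.
  exact: measurable_funS.
have zs0 s : `]t, 1[%classic s -> (0 <= (z s / s)%:E)%E.
  rewrite /= in_itv/= => /andP[ts _].
  by rewrite lee_fin divr_ge0// ltW// (lt_trans t0).
have Efin (D : set R) (f : R -> R) : (0 <= \int[leb]_(s in D) (f s)%:E)%E ->
    (\int[leb]_(s in D) (f s)%:E < +oo)%E ->
    (Rintegral leb D f)%:E = (\int[leb]_(s in D) (f s)%:E)%E.
  by move=> h1 h2; rewrite fineK// ge0_fin_numE.
rewrite mulrDr mulr1 /calderon; apply: lerD.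
  rewrite ler_pdivlMl// -lee_fin Efin//; last 2 first.
  - exact: integral_ge0.
  - apply: le_lt_trans zE; apply: ge0_subset_integral;
      [exact: mI|exact: mI|exact: mEz|by move=> s _; exact: zE0|exact: sl].
  rewrite mulrC EFinM.
  have <- : leb `]0, t[%classic = t%:E.
    by rewrite lebesgue_measure_itv/= lte_fin t0 sube0.
  rewrite -(integral_cst leb (mI 0 t)); apply: ge0_le_integral => //.
    exact: measurable_funS mEz.
  move=> s /=; rewrite in_itv/= => /andP[s0 st].
  by rewrite lee_fin az// s0 (lt_trans st).
rewrite -lee_fin Efin; last 2 first.
- exact: integral_ge0.
- apply: (@le_lt_trans _ _ ((t^-1)%:E * \int[leb]_(s in I01) (z s)%:E)%E); last first.
    by rewrite lte_mul_pinfty// ?ge0_fin_numE ?lee_fin ?invr_ge0 ?ltry// ltW.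
  have ti : (0 <= (t^-1)%:E)%E by rewrite lee_fin invr_ge0 ltW.
  apply: (@le_trans _ _ ((t^-1)%:E * \int[leb]_(s in `]t, 1%R[) (z s)%:E)%E); last first.
    apply: lee_wpmul2l; first exact: ti.
    apply: ge0_subset_integral;
      [exact: mI|exact: mI|exact: mEz|by move=> s _; exact: zE0|exact: sr].
  rewrite -ge0_integralZl//; last exact: measurable_funS mEz.
  apply: ge0_le_integral => //.
    by apply: measurable_funeM; exact: measurable_funS mEz.
  move=> s /=; rewrite in_itv/= => /andP[ts _].
  by rewrite lee_fin mulrC ler_wpM2r// lef_pV2 ?posrE// ?ltW// (lt_trans t0).
apply: (@le_trans _ _ (\int[leb]_(s in `]t, v[) (z s / s)%:E)%E); last first.
  by apply: ge0_subset_integral; [exact: mI|exact: mI|exact: mzs|exact: zs0|exact: sm].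
have -> : (a * ln (v / t))%:E = (\int[leb]_(s in `]t, v[) (a%:E * (s^-1)%:E))%E.
  rewrite ge0_integralZl//.
  - by rewrite integral_invr// -EFinM ln_div.
  - apply: (@measurable_funS _ _ _ _ I01) => //.
      by move=> s /sm /sr.
    by apply/measurable_EFinP; exact: measurable_invr01.
  - move=> s /=; rewrite in_itv/= => /andP[ts _].
    by rewrite lee_fin invr_ge0 ltW// (lt_trans t0).
apply: ge0_le_integral => //.
- move=> s /=; rewrite in_itv/= => /andP[ts _].
  by rewrite mule_ge0// lee_fin invr_ge0 ltW// (lt_trans t0).
- apply: measurable_funeM; apply: (@measurable_funS _ _ _ _ I01) => //.
    by move=> s /sm /sr.
  by apply/measurable_EFinP; exact: measurable_invr01.
- exact: measurable_funS mzs.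
move=> s /=; rewrite in_itv/= => /andP[ts sv].
rewrite -EFinM lee_fin ler_wpM2r ?invr_ge0 ?(ltW (lt_trans t0 ts))// az//.
by rewrite (lt_trans t0 ts).
Qed.

End LowerBounds.

(** * Majorizing a rearrangement by a Calderon transform *)
(** Besides quasi-concavity and positivity, the only link between phi and psi
    that is used is the majorization of indicators. *)
Section Majorant.
Context {R : realType}.
Implicit Types (x y z : R -> R) (s t u v a : R).
Local Notation RR := (measurableTypeR R).
Local Notation I01 := (`]0, 1[%classic : set R).
Local Notation leb := (@lebesgue_measure R).
Local Notation dS F := (lebesgue_stieltjes_measure (stieltjes_ext F)).

Let mI (a b : R) : measurable (`]a, b[%classic : set R).
Proof. exact: measurable_itv. Qed.

Variables (phi psi : R -> R).
Hypothesis qphi : quasiconcave phi.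
Hypothesis qpsi : quasiconcave psi.
Hypothesis phi_gt0 : forall t, 0 < t -> t < 1 -> 0 < phi t.
Hypothesis psi_gt0 : forall t, 0 < t -> t < 1 -> 0 < psi t.
Hypothesis majorant : forall u, 0 <= u <= 1 -> exists p : R * R,
  [/\ 0 <= p.2, 0 <= p.1 <= 1,
      (forall t, 0 < t < u -> t < p.1 /\ 1 <= p.2 * (1 + ln (p.1 / t))) &
      (p.2%:E * dS phi `]0%R, p.1[%classic <=
       (3 / 2)%:E * dS psi `]0%R, u[%classic)%E].

Let phi_half : 0 < phi 2^-1. Proof. by apply: phi_gt0; lra. Qed.

(** The function y is the constant d plus the sum over k of 2^(k+1) d times the
    majorant of the indicator of ]0, d_x(2^k d)[. The factor 6 is 3/2, from the
    majorants, times 4, from the dyadic inequality. *)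
Lemma rearrangement_majorant x (d : R) : measurable_fun I01 x -> 0 < d ->
  (lorentz_norm psi x < +oo)%E ->
  exists y : R -> R,
    [/\ lorentz phi y,
        (forall t, 0 < t < 1 -> rearrangement x t <= calderon (rearrangement y) t) &
        (lorentz_norm phi y <= d%:E * dS phi `]0%R, 1%R[%classic +
           6%:E * lorentz_norm psi x)%E].
Proof.
move=> mx d0 xfin.
pose u (k : nat) := fine (distribution x (2 ^+ k * d)).
have u01 k : 0 <= u k <= 1.
  rewrite /u fine_ge0//= -lee_fin fineK ?distribution_fin//.
  exact: distribution_le1.
have [p Hp] := choice (fun k => majorant (u01 k)).
have A0 k : 0 <= (p k).2 by have [] := Hp k.
have v1 k : (p k).1 <= 1 by have [_ /andP[_ ?] _ _] := Hp k.
pose a (k : nat) := 2 ^+ k.+1 * d * (p k).2.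
have a0 k : 0 <= a k by rewrite /a !mulr_ge0// ?exprn_ge0// ltW.
pose f (k : nat) (s : R) : \bar R := if s < (p k).1 then (a k)%:E else 0%E.
have f0 k s : (0 <= f k s)%E by rewrite /f; case: ifP => _; rewrite ?lee_fin.
have fni k s t : s <= t -> (f k t <= f k s)%E.
  move=> st; rewrite /f; case: ifPn => [tv|_]; last first.
    by case: ifPn => _; rewrite ?lee_fin.
  by rewrite (le_lt_trans st tv).
have mf k : measurable_fun I01 (f k).
  apply: nonincreasing_emeasurable; first exact: interval_is_interval.
  by move=> s t _ _; exact: fni.
have [S SE] : {S : R -> \bar R | S = fun s => (\sum_(0 <= k <oo) f k s)%E} by eexists.
have S0 s : (0 <= S s)%E by rewrite SE; apply: nneseries_ge0 => k _ _; exact: f0.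
have fS k s : (f k s <= S s)%E.
  rewrite SE; apply: le_trans (@nneseries_lim_ge _ (f^~ s) xpredT 0 k.+1 _).
    by rewrite big_nat_recr//= leeDr// sume_ge0.
  by move=> i _ _; exact: f0.
have Sni s t : s <= t -> (S t <= S s)%E.
  by move=> st; rewrite SE; apply: lee_nneseries => [k _ _|k _]; [exact: f0|exact: fni].
(* Y takes values in the extended reals; it is finite on (0,1) because it is
   nonincreasing with finite integral against dphi. *)
pose Y s := (d%:E + S s)%E.
have Y0 s : (0 <= Y s)%E by rewrite adde_ge0// lee_fin ltW.
have Yni s t : s <= t -> (Y t <= Y s)%E.
  by move=> st; rewrite /Y leeD2l//; exact: Sni.
have mY : measurable_fun I01 Y.
  apply: nonincreasing_emeasurable; first exact: interval_is_interval.
  by move=> s t _ _; exact: Yni.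
have mS : measurable_fun I01 S.
  apply: nonincreasing_emeasurable; first exact: interval_is_interval.
  by move=> s t _ _; exact: Sni.
set N := (d%:E * dS phi `]0%R, 1%R[%classic + 6%:E * lorentz_norm psi x)%E.
have x0 := lorentz_norm_ge0 psi x.
have Nfin : (N < +oo)%E.
  apply: lte_add_pinfty.
    apply: lte_mul_pinfty; [by rewrite lee_fin ltW|by []|].
    by rewrite -ge0_fin_numE//; apply: stieltjes_measure_fin; rewrite ?lexx.
  exact: lte_mul_pinfty.
have YN : (\int[dS phi]_(s in I01) Y s <= N)%E.
  have d0e (t : R) : I01 t -> (0 <= d%:E :> \bar R)%E by rewrite lee_fin (ltW d0).
  rewrite (ge0_integralD (dS phi) (mI 0 1) d0e (measurable_cst _)
    (fun t _ => S0 t) mS).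
  rewrite (integral_cst (dS phi) (mI 0 1)); apply: leeD; first exact: lexx.
  rewrite SE (integral_nneseries (dS phi) (mI 0 1) mf (fun n t _ => f0 n t)).
  apply: (@le_trans _ _ ((3 / 2)%:E * (4%:E * lorentz_norm psi x))%E); last first.
    by rewrite muleA -EFinM; apply: lee_wpmul2r; [exact: x0|rewrite lee_fin; lra].
  have h32 : (0 <= (3 / 2)%:E :> \bar R)%E by rewrite lee_fin divr_ge0.
  apply: le_trans (lee_wpmul2l h32 (dyadic_distribution_le psi mx d0)).
  rewrite -nneseriesZl; last first.
    by move=> k _; apply: mule_ge0; rewrite ?lee_fin// mulr_ge0 ?exprn_ge0// ltW.
  apply: lee_nneseries => [k _ _|k _].
    by apply: integral_ge0 => s _; exact: f0.
  have [_ /andP[pk0 pk1] _ Hk] := Hp k.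
  have p2 : (0 <= (2 ^+ k.+1 * d)%:E)%E by rewrite lee_fin mulr_ge0 ?exprn_ge0// ltW.
  rewrite muleCA; apply: le_trans (lee_wpmul2l p2 Hk).
  rewrite muleA -EFinM -(integral_cst (dS phi) (mI 0 (p k).1)).
  rewrite integral_mkcond [leRHS]integral_mkcond.
  rewrite le_eqVlt; apply/orP; left; apply/eqP/eq_integral => s _.
  rewrite !patchE /f; have -> : (s \in `]0, (p k).1[%classic) =
      (s \in I01) && (s < (p k).1).
    apply/idP/andP; rewrite !inE/= !in_itv/=.
      by move=> /andP[-> h]; rewrite h (lt_le_trans h).
    by move=> [/andP[-> _] ->].
  by case: (s \in I01) => //=; case: ifP.
have Yfin t : 0 < t -> t < 1 -> Y t \is a fin_num.
  move=> t0 t1; rewrite ge0_fin_numE//.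
  have pt := phi_gt0 t0 t1.
  have : (Y t * (phi t)%:E < +oo)%E.
    apply: le_lt_trans Nfin; apply: le_trans YN.
    apply: (@le_trans _ _ (\int[dS phi]_(s in `]0%R, t[) Y t)%E).
      rewrite (integral_cst (dS phi) (mI 0 t)).
      by apply: lee_wpmul2l; [exact: Y0|exact: stieltjes_measure_oo_ge].
    have sl : `]0, t[%classic `<=` I01.
      by move=> s /=; rewrite !in_itv/= => /andP[-> /lt_trans]; exact.
    apply: (@le_trans _ _ (\int[dS phi]_(s in `]0%R, t[) Y s)%E).
      apply: ge0_le_integral; [exact: mI|by move=> s _; exact: Y0|
        exact: measurable_cst| |].
        by apply: measurable_funS mY => //.
      by move=> s /=; rewrite in_itv/= => /andP[_ /ltW]; exact: Yni.
    by apply: ge0_subset_integral; [exact: mI|exact: mI|exact: mY|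
      by move=> s _; exact: Y0|exact: sl].
  move: (Y0 t); case: (Y t) => [r| |//] _; first by move=> _; exact: ltry.
  by rewrite mulyr gtr0_sg// mul1e.
pose y s := fine (Y s).
have yE s : 0 < s < 1 -> (y s)%:E = Y s.
  by move=> /andP[s0 s1]; rewrite /y fineK// Yfin.
have y0 s : 0 <= y s by rewrite /y fine_ge0.
have my : measurable_fun I01 y.
  apply/measurable_EFinP; apply: (eq_measurable_fun Y); last exact: mY.
  by move=> s; rewrite inE/= in_itv/= => s01; rewrite /= yE.
have yN : (lorentz_norm phi y <= N)%E.
  apply: le_trans YN; apply: ge0_le_integral; first exact: mI.
  - by move=> s _; rewrite lee_fin rearrangement_ge0.
  - by apply/measurable_EFinP; exact: measurable_rearrangement.
  - exact: mY.
  move=> t /=; rewrite in_itv/= => t01; apply: rearrangement_le_nonincreasing => //.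
    by move=> s s01; rewrite ger0_norm// yE.
  by move=> s t' _ st _; exact: Yni.
have Ly : lorentz phi y by split; [exact: my|exact: (le_lt_trans yN Nfin)].
exists y; split; [exact: Ly| |exact: yN].
have h0 : 0 < (2^-1 : R) by lra.
have h1 : (2^-1 : R) < 1 by lra.
have L1y : L1 (rearrangement y).
  apply: (lorentz_sub_L1 qphi h0 h1 phi_half).
  exact: lorentz_rearrangement.
have ry0 s : 0 <= rearrangement y s by exact: rearrangement_ge0.
have yd s : 0 < s < 1 -> d <= y s.
  by move=> s01; rewrite -lee_fin yE// /Y leeDl.
have ya k s : 0 < s < (p k).1 -> a k <= y s.
  move=> /andP[s0 sv]; have s1 : s < 1 by exact: lt_le_trans (v1 k).
  rewrite -lee_fin yE ?s0//; apply: (@le_trans _ _ (f k s)).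
    by rewrite /f sv.
  by apply: (le_trans (fS k s)); rewrite /Y leeDr// lee_fin ltW.
move=> t /andP[t0 t1].
(* Below the level d the constant term of y suffices; above it, the term whose
   index n satisfies 2^n d < rearrangement x t <= 2^(n+1) d. *)
have [xd|dx] := leP (rearrangement x t) d.
  apply: (le_trans xd).
  apply: (@le_trans _ _ (d * (1 + ln (1 / t)))).
    rewrite ler_peMr ?(ltW d0)// lerDl ln_ge0// mul1r.
    by rewrite invf_ge1// ltW.
  apply: (calderon_ge L1y ry0 (ltW d0) (lexx 1)); last by rewrite t0.
  by move=> s s01; apply: (rearrangement_ge_cst my (lexx 1)).
have : 1 < rearrangement x t / d by rewrite ltr_pdivlMr// mul1r.
move=> /dyadic_exists[n /andP[n1 n2]].
rewrite ltr_pdivlMr// in n1; rewrite ler_pdivrMr// in n2.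
have tu : t < u n.
  rewrite -lte_fin fineK ?distribution_fin//; apply: rearrangement_gt => //.
  by rewrite mulr_ge0 ?exprn_ge0// ltW.
have [_ _ Hn _] := Hp n.
have [|tv Hn2] := Hn t; first by rewrite t0.
apply: (le_trans n2).
apply: (@le_trans _ _ (a n * (1 + ln ((p n).1 / t)))).
  rewrite /a -mulrA ler_peMr// mulr_ge0 ?exprn_ge0//; exact: ltW.
apply: (calderon_ge L1y ry0 (a0 n) (v1 n)); last by rewrite t0.
by move=> s sv; apply: (rearrangement_ge_cst my (v1 n)) => // r; exact: ya.
Qed.

(** When the norm of x vanishes its rearrangement is 0 on (0,1), and y = 0. *)
Lemma lorentz_calderon_majorant x : lorentz psi x ->
  exists y : R -> R,
    [/\ lorentz phi y,
        (forall t, 0 < t < 1 -> rearrangement x t <= calderon (rearrangement y) t) &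
        (lorentz_norm phi y <= 8%:E * lorentz_norm psi x)%E].
Proof.
move=> [mx xfin]; have x0 := lorentz_norm_ge0 psi x.
have [xz|xn0] := eqVneq (lorentz_norm psi x) 0%E.
  have my : measurable_fun I01 (cst 0 : R -> R) by exact: measurable_cst.
  have yN : (lorentz_norm phi (cst 0%R : R -> R) <= 0)%E.
    rewrite le_eqVlt; apply/orP; left; apply/eqP; apply: integral0_eq => t /=.
    rewrite in_itv/= => t01; apply/le_anti/andP; split; last first.
      by rewrite lee_fin rearrangement_ge0.
    apply: (@rearrangement_le_nonincreasing _ _ (cst 0%E)) => //.
    by move=> u _; rewrite normr0.
  exists (cst 0); split.
  - by split; [exact: my|exact: (le_lt_trans yN (ltry 0))].
  - move=> t /andP[t0 t1]; apply: (@le_trans _ _ 0); last first.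
      by apply: calderon_ge0 => // s; exact: rearrangement_ge0.
    have := lorentz_norm_ge qpsi mx t0 t1.
    by rewrite xz lee_fin pmulr_lle0// psi_gt0.
  - by rewrite xz mule0.
have Bfin : dS phi `]0%R, 1%R[%classic \is a fin_num.
  by apply: stieltjes_measure_fin; rewrite ?lexx.
have xf : lorentz_norm psi x \is a fin_num by rewrite ge0_fin_numE.
pose N := fine (lorentz_norm psi x).
pose B := fine (dS phi `]0%R, 1%R[%classic).
have N0 : 0 < N.
  by rewrite -lte_fin /N fineK// lt_neqAle eq_sym xn0.
have B0 : 0 < B.
  apply: (lt_le_trans phi_half); rewrite -lee_fin /B fineK//.
  by apply: stieltjes_measure_01_ge => //; lra.
have [y [Ly Hy yN]] := rearrangement_majorant mx (divr_gt0 N0 B0) xfin.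
exists y; split; [exact: Ly|exact: Hy|apply: (le_trans yN)].
rewrite -(fineK Bfin) -(fineK xf) -/N -/B -!EFinM -EFinD lee_fin.
by rewrite divfK ?gt_eqF//; lra.
Qed.

End Majorant.

(** * The theorem *)
Theorem theorem19 (R : realType) (phi : R -> R)
  (phi01 : forall t : R, t \in `[0, 1[ -> 0 <= phi t < 1)
  (phi_incr : {in `[0, 1[ &, {homo phi : s t / s <= t}})
  (phi_neq0 : exists2 t : R, t \in `]0, 1[ & phi t != 0)
  (phi_concave : concave01 phi)
  (phi0 : phi t @[t --> 0^'+] --> (0 : R))
  (c : R)
  (phi_psi : forall u : R, u \in `]0, 1[ ->
    (\int[@lebesgue_measure R]_(t in `]0%R, u[) (psi_of phi t / t)%:E
     + u%:E * \int[@lebesgue_measure R]_(t in `]u, 1%R[)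
                (psi_of phi t / t ^+ 2)%:E
     <= (c * phi u)%:E)%E) :
  calderon_bounded phi (psi_of phi) /\
  (forall x : R -> R, lorentz (psi_of phi) x ->
     exists y : R -> R,
       [/\ lorentz phi y,
           {ae @lebesgue_measure R, forall t : R, t \in `]0, 1[ ->
              rearrangement x t <= calderon (rearrangement y) t} &
           (lorentz_norm phi y <= 8%:E * lorentz_norm (psi_of phi) x)%E]).
Proof.
have qphi := concave_quasiconcave phi01 phi_incr phi_concave phi0.
have qpsi := psi_of_quasiconcave phi01 phi_incr phi_neq0 phi_concave phi0.
have phi_gt0 := concave01_gt0 phi01 phi_incr phi_neq0 phi_concave phi0.
have psi_gt0 := psi_of_gt0 phi01 phi_incr phi_neq0 phi_concave phi0.
split; first exact: (calderon_bounded_lorentz qphi qpsi phi_gt0 phi_psi).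
move=> x Lx.
have majorant := psi_of_majorant phi01 phi_incr phi_neq0 phi_concave phi0.
have [y [Ly Hy yN]] :=
  lorentz_calderon_majorant qphi qpsi phi_gt0 psi_gt0 majorant Lx.
exists y; split; [exact: Ly| |exact: yN].
by apply: aeW => t; rewrite in_itv/=; exact: Hy.
Qed.
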